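(* There is a quantum algorithm which, given $\varepsilon>0$ and oracle access to an unknown quantum $k$-junta $U\in\mathcal{U}_N$ on $n$ qubits, outputs, with probability at least $9/10$, a classical description of a unitary $\widehat{U}$ with $\mathrm{dist}(U,\widehat{U})\le\varepsilon$, and makes $O\!\left(\frac{k}{\varepsilon}+\frac{4^k}{\varepsilon^2}\right)$ queries to $U$.
   Context: $N=2^n$, $\mathcal{U}_N$ is the set of $N\times N$ unitaries. A unitary $U\in\mathcal{U}_N$ is a quantum $k$-junta if $U=V_S\otimes I_{\overline{S}}$ for some $S\subseteq[n]$ with $|S|=k$ and some $V_S\in\mathcal{U}_{2^k}$ acting on the qubits in $S$ (identity on the remaining qubits). For $A,B\in\mathbb{C}^{N\times N}$, $\mathrm{dist}(A,B):=\min_{\theta\in[0,2\pi)}\frac{1}{\sqrt{2N}}\|e^{i\theta}A-B\|$ with $\|\cdot\|$ the Frobenius norm. An oracle for $U$ maps $|\psi\rangle\mapsto U|\psi\rangle$. *)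

(* Defs.v *)
From HB Require Import structures.
From mathcomp Require Import all_boot all_order all_algebra.
From mathcomp Require Import complex mxtens.
From mathcomp Require Import boolp classical_sets reals.
Set Implicit Arguments. Unset Strict Implicit. Unset Printing Implicit Defensive.
Import Order.TTheory GRing.Theory Num.Theory.
Local Open Scope ring_scope.
Local Open Scope classical_set_scope.

Lemma pow2_gt0 (k : nat) : (0 < 2 ^ k)%N.
Proof. by rewrite expn_gt0. Qed.

Section Quantum.
Variable R : realType.
Local Notation C := R[i].

Definition cabs (z : C) : R := ComplexField.Normc.normc z.

Definition adjmx (m n : nat) (A : 'M[C]_(m, n)) : 'M[C]_(n, m) :=
  (map_mx (@conjc R) A)^T.

Definition unitary (d : nat) (A : 'M[C]_d) : Prop :=
  adjmx A *m A = 1%:M /\ A *m adjmx A = 1%:M.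

Definition frob (m n : nat) (A : 'M[C]_(m, n)) : R :=
  Num.sqrt (\sum_(i < m) \sum_(j < n) cabs (A i j) ^+ 2).

(* dist(A,B) = min over global phases e^{i theta} of ||e^{i theta} A - B|| / sqrt(2d);
   the minimum is attained, so it equals the infimum over unit-modulus c. *)
Definition qdist (d : nat) (A B : 'M[C]_d) : R :=
  inf [set frob (c *: A - B) / Num.sqrt (2 * d)%:R | c in [set c : C | cabs c = 1]].

Definition qbit (n : nat) (x : 'I_(2 ^ n)) (i : 'I_n) : bool :=
  odd (x %/ 2 ^ i).

Definition ordmod (k m : nat) : 'I_(2 ^ k) := Ordinal (ltn_pmod m (pow2_gt0 k)).

(* the basis index, in the 2^|S|-dimensional space of the qubits in S, of the
   restriction of x to S (qubits of S ordered by enum S) *)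
Definition restr_idx (n k : nat) (S : {set 'I_n}) (x : 'I_(2 ^ n)) : 'I_(2 ^ k) :=
  ordmod k (\sum_(i <- enum S) qbit x i * 2 ^ (index i (enum S))).

(* the matrix V_S (x) I_{complement of S} *)
Definition junta_mx (n k : nat) (S : {set 'I_n}) (V : 'M[C]_(2 ^ k)) : 'M[C]_(2 ^ n) :=
  \matrix_(x, y) (if [forall i in ~: S, qbit x i == qbit y i]
                  then V (restr_idx k S x) (restr_idx k S y) else 0).

Definition is_junta (n k : nat) (U : 'M[C]_(2 ^ n)) : Prop :=
  exists S : {set 'I_n}, #|S| = k /\
  exists V : 'M[C]_(2 ^ k), unitary V /\ U = junta_mx S V.

(* An algorithm with oracle access to U in U_{2^n} uses n + m qubits, starts in
   |0...0>, alternates fixed unitaries G_0, ..., G_T with T applications of the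
   oracle U (x) I_{2^m}, measures all qubits in the computational basis and
   outputs (by arbitrary classical post-processing of the outcome) a classical
   description of a unitary.  Intermediate measurements and adaptivity are
   covered by the principle of deferred measurement. *)
Record query_alg (n : nat) := QueryAlg {
  anc : nat;
  nqueries : nat;
  gate : nat -> 'M[C]_(2 ^ n * 2 ^ anc);
  gate_unitary : forall t, unitary (gate t);
  output : 'I_(2 ^ n * 2 ^ anc) -> 'M[C]_(2 ^ n);
  output_unitary : forall o, unitary (output o)
}.
Arguments anc {n} q.
Arguments nqueries {n} q.
Arguments gate {n} q _.
Arguments output {n} q _.

Lemma dim_gt0 (n m : nat) : (0 < 2 ^ n * 2 ^ m)%N.
Proof. by rewrite muln_gt0 !pow2_gt0. Qed.

Definition zero_idx (n m : nat) : 'I_(2 ^ n * 2 ^ m) := Ordinal (dim_gt0 n m).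

Fixpoint run_state (n : nat) (A : query_alg n) (U : 'M[C]_(2 ^ n)) (t : nat)
  : 'cV[C]_(2 ^ n * 2 ^ anc A) :=
  match t with
  | 0 => gate A 0 *m delta_mx (zero_idx n (anc A)) 0
  | t'.+1 => gate A t *m ((U *t (1%:M : 'M[C]_(2 ^ anc A))) *m run_state A U t')
  end.

Definition final_state (n : nat) (A : query_alg n) (U : 'M[C]_(2 ^ n)) :=
  run_state A U (nqueries A).

Definition success_prob (n : nat) (A : query_alg n) (U : 'M[C]_(2 ^ n)) (eps : R) : R :=
  \sum_(o < 2 ^ n * 2 ^ anc A | qdist U (output A o) <= eps)
     cabs (final_state A U o 0) ^+ 2.

End Quantum.

(* Main.v *)
Require Import Defs.
From HB Require Import structures.
From mathcomp Require Import all_boot all_order all_algebra.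
From mathcomp Require Import complex mxtens.
From mathcomp Require Import boolp classical_sets reals.
From mathcomp Require Import ring lra.
Import Order.TTheory GRing.Theory Num.Theory.
Local Open Scope ring_scope.
Set Implicit Arguments.
Unset Strict Implicit.
Unset Printing Implicit Defensive.

(** Since the distance never exceeds 1, no query is needed when eps >= 1; otherwise
    k / eps is dominated by 4^k / eps^2 and it suffices to use m = O(4^k / eps^2)
    copies of one fixed state, each prepared with a single query: a superposition of
    two copies of U|0> and of the Choi state of U.  All copies are prepared by one
    circuit and measured adaptively at the end.
    - In the basis made of computational vectors (for U|0>) and Pauli vectors (for the
      Choi state) the coordinates of the state are supported on subsets of the relevant
      set S.  The union S' of the supports of m sampled basis vectors misses weight at
      most k / m on average, because x (1 - x)^m <= 1 / m.
    - One more sample yields a basis vector y0 with |<y0|U|0>|^2 at least of order 2^-k.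
    - Interfering a reference vector e with d further basis vectors, under the phases
      1, -1, i, -i, estimates the d products conj(<e, a>) a_j with total mean square
      error d / m.  With e = y0 and the 2^k computational vectors over S' this gives a
      vector of constant overlap with U|0>; with that vector as the new reference and
      the 4^k Pauli vectors over S' it gives the Pauli coefficients of U, up to a common
      factor of constant modulus, with square error O(4^k / m) = O(eps^2).
    - Any unitary whose Pauli coefficients are, up to a factor, that close to the
      estimate is within eps of U. *)

Local Notation Re := complex.Re.
Local Notation Im := complex.Im.

(** * Squared moduli of complex numbers, as polynomials in real and imaginary parts *)

Section SquaredModulus.
Variable R : realType.
Local Notation C := R[i].
Implicit Types (x y z : C).

Definition abs2 z : R := cabs z ^+ 2.

Lemma abs2E z : abs2 z = Re z ^+ 2 + Im z ^+ 2.
Proof.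
by case: z => a b; rewrite /abs2 /cabs /= sqr_sqrtr // addr_ge0 // sqr_ge0.
Qed.

Lemma abs2_ge0 z : 0 <= abs2 z.
Proof. exact: sqr_ge0. Qed.

Lemma cabs_ge0 z : 0 <= cabs z.
Proof. by case: z => a b; rewrite /cabs /= sqrtr_ge0. Qed.

Lemma cabsE z : cabs z = Num.sqrt (abs2 z).
Proof. by rewrite /abs2 sqrtr_sqr ger0_norm // cabs_ge0. Qed.

Lemma abs2M x y : abs2 (x * y) = abs2 x * abs2 y.
Proof. by rewrite /abs2 /cabs ComplexField.Normc.normcM exprMn. Qed.

Lemma abs2_conj z : abs2 (conjc z) = abs2 z.
Proof. by rewrite !abs2E; case: z => a b /=; rewrite sqrrN. Qed.

Lemma abs2_0 : abs2 0 = 0.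
Proof. by rewrite abs2E /= expr0n addr0. Qed.

Lemma abs2_1 : abs2 1 = 1.
Proof. by rewrite abs2E /= expr0n addr0 expr1n. Qed.

Lemma abs2R (a : R) : abs2 (a%:C)%C = a ^+ 2.
Proof. by rewrite abs2E /= expr0n addr0. Qed.

Lemma abs2N z : abs2 (- z) = abs2 z.
Proof. by rewrite !abs2E; case: z => a b /=; rewrite !sqrrN. Qed.

Lemma abs2_eq0 z : (abs2 z == 0) = (z == 0).
Proof.
apply/eqP/eqP => [h|->]; last exact: abs2_0.
apply: ComplexField.Normc.eq0_normc.
by apply/eqP; rewrite -sqrf_eq0; apply/eqP.
Qed.

Lemma abs2C z : ((abs2 z)%:C)%C = conjc z * z.
Proof. by rewrite abs2E; case: z => a b /=; simpc; congr Complex; ring. Qed.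

Lemma abs2CE z : abs2 z = Re (conjc z * z).
Proof. by rewrite -abs2C. Qed.

Lemma abs2B z y : abs2 (z - y) = abs2 z + abs2 y - 2 * Re (conjc z * y).
Proof. by rewrite !abs2E; case: z => a b; case: y => c d /=; ring. Qed.

Lemma abs2_distC z y : abs2 (z - y) = abs2 (y - z).
Proof. by rewrite -abs2N opprB. Qed.

Lemma abs2_triangle x y z : abs2 (x - z) <= 2 * abs2 (x - y) + 2 * abs2 (y - z).
Proof.
rewrite !abs2E; case: x => a b; case: y => c d; case: z => e f /=.
have h1 := sqr_ge0 (a - c - (c - e)).
have h2 := sqr_ge0 (b - d - (d - f)).
by nra.
Qed.

Lemma Re_le_cabs z : Re z <= cabs z.
Proof.
rewrite cabsE abs2E; apply: (le_trans (ler_norm _)).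
rewrite -sqrtr_sqr ler_sqrt ?lerDl ?sqr_ge0 //.
by rewrite addr_ge0 ?sqr_ge0.
Qed.

Lemma ReB x y : Re (x - y) = Re x - Re y.
Proof. by case: x; case: y. Qed.

Lemma ImB x y : Im (x - y) = Im x - Im y.
Proof. by case: x; case: y. Qed.

Lemma ReMr (a : R) z : Re ((a%:C)%C * z) = a * Re z.
Proof. by case: z => c d /=; rewrite mul0r subr0. Qed.

Lemma ImMr (a : R) z : Im ((a%:C)%C * z) = a * Im z.
Proof. by case: z => c d /=; rewrite mul0r addr0. Qed.

Lemma Re_sum (T : Type) (r : seq T) (P : pred T) (F : T -> C) :
  Re (\sum_(i <- r | P i) F i) = \sum_(i <- r | P i) Re (F i).
Proof. by apply: (big_morph (@complex.Re R)) => // -[a b] [c d]. Qed.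

Lemma Im_sum (T : Type) (r : seq T) (P : pred T) (F : T -> C) :
  Im (\sum_(i <- r | P i) F i) = \sum_(i <- r | P i) Im (F i).
Proof. by apply: (big_morph (@complex.Im R)) => // -[a b] [c d]. Qed.

Lemma conjcM x y : conjc (x * y) = conjc x * conjc y.
Proof. exact: rmorphM. Qed.

Lemma conjcD x y : conjc (x + y) = conjc x + conjc y.
Proof. exact: rmorphD. Qed.

Lemma conjc_sum (T : Type) (r : seq T) (P : pred T) (F : T -> C) :
  conjc (\sum_(i <- r | P i) F i) = \sum_(i <- r | P i) conjc (F i).
Proof. exact: (rmorph_sum (@conjc R)). Qed.

Lemma conjc_prod (T : Type) (r : seq T) (P : pred T) (F : T -> C) :
  conjc (\prod_(i <- r | P i) F i) = \prod_(i <- r | P i) conjc (F i).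
Proof. exact: (rmorph_prod (@conjc R)). Qed.

Lemma conjc_bool (b : bool) : conjc (b%:R : C) = b%:R.
Proof. exact: conjc_nat. Qed.

Lemma abs2_bool (b : bool) : abs2 (b%:R : C) = b%:R.
Proof. by case: b; rewrite ?abs2_1 ?abs2_0. Qed.

Lemma abs2_prod (T : Type) (r : seq T) (P : pred T) (F : T -> C) :
  abs2 (\prod_(i <- r | P i) F i) = \prod_(i <- r | P i) abs2 (F i).
Proof. by apply: (big_morph abs2) => [x y|]; rewrite ?abs2M ?abs2_1. Qed.

End SquaredModulus.

(** * Sums against Kronecker deltas *)

Section DeltaSums.
Variables (A : nzRingType) (T : finType).

Lemma sum_deltal (x : T) (F : T -> A) : \sum_y (x == y)%:R * F y = F x.
Proof.
rewrite (bigD1 x) //= eqxx mul1r big1 ?addr0 // => y.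
by rewrite eq_sym => /negPf ->; rewrite mul0r.
Qed.

Lemma sum_delta_sym (x : T) (F : T -> A) : \sum_y (y == x)%:R * F y = F x.
Proof. by under eq_bigr => y _ do rewrite eq_sym; exact: sum_deltal. Qed.

Lemma sum_deltar (x : T) (F : T -> A) : \sum_y F y * (x == y)%:R = F x.
Proof.
rewrite (bigD1 x) //= eqxx mulr1 big1 ?addr0 // => y.
by rewrite eq_sym => /negPf ->; rewrite mulr0.
Qed.

End DeltaSums.

(** * Independent samples from a finite distribution *)

Section FiniteProbability.
Variable R : realType.
Variable O : finType.
Variable p : O -> R.
Hypothesis p_ge0 : forall o, 0 <= p o.
Hypothesis p_sum1 : \sum_o p o = 1.

(** Markov's inequality: the outcomes with f > theta weigh at most delta. Outcomes of probability
    zero are exempt from the test, so [good] may include properties that hold only almost surely. *)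
Lemma markov (f : O -> R) (theta delta : R) (good : pred O) :
  0 < theta -> (forall o, 0 <= f o) -> \sum_o p o * f o <= delta * theta ->
  (forall o, p o != 0 -> f o <= theta -> good o) ->
  1 - delta <= \sum_(o | good o) p o.
Proof.
move=> t0 f0 hE hg.
have : \sum_(o | ~~ good o) p o <= delta.
  rewrite -(ler_pM2r t0); apply: le_trans hE.
  rewrite mulr_suml big_mkcond /=; apply: ler_sum => o _.
  case: ifPn => [ng|_]; last by rewrite mulr_ge0.
  have [->|pn0] := eqVneq (p o) 0; first by rewrite !mul0r.
  rewrite ler_wpM2l // leNgt; apply/negP => /ltW h.
  by move/negP: ng; apply; apply: hg.
have := p_sum1; rewrite (bigID good) /=; lra.
Qed.

Variable m : nat.
Implicit Type o : {ffun 'I_m -> O}.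

Definition iid o : R := \prod_k p (o k).

Lemma iid_ge0 o : 0 <= iid o.
Proof. by apply: prodr_ge0. Qed.

Lemma iid_prod (h : 'I_m -> O -> R) :
  \sum_o iid o * \prod_k h k (o k) = \prod_k \sum_x p x * h k x.
Proof. by rewrite bigA_distr_bigA /=; apply: eq_bigr => o _; rewrite big_split. Qed.

Lemma iid_sum1 : \sum_o iid o = 1.
Proof.
transitivity (\prod_(k < m) \sum_x p x * 1).
  rewrite -iid_prod; apply: eq_bigr => o _.
  by rewrite big1 ?mulr1.
by rewrite big1 // => k _; under eq_bigr => x _ do rewrite mulr1.
Qed.

(** The indicator is a product of one indicator per sample, so the mean factors. *)
Lemma iid_miss (B : pred O) :
  \sum_o iid o * [forall k, ~~ B (o k)]%:R = (1 - \sum_(x | B x) p x) ^+ m.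
Proof.
transitivity (\prod_(k < m) \sum_x p x * (~~ B x)%:R).
  rewrite -iid_prod; apply: eq_bigr => o _; congr (_ * _).
  case: forallP => [h|/forallP]; first by rewrite big1 // => k _; rewrite h.
  rewrite negb_forall => /existsP[k hk].
  by rewrite (bigD1 k) //= (negPf hk) mul0r.
rewrite prodr_const card_ord; congr (_ ^+ _).
transitivity (\sum_(x | ~~ B x) p x); last first.
  by have := p_sum1; rewrite (bigID B) /=; lra.
by rewrite [RHS]big_mkcond; apply: eq_bigr => x _; case: (B x); rewrite /= ?mulr0 ?mulr1.
Qed.

(** [h] writes g(o_k) g(o_l) as a product over all positions, so the mean factors; for k <> l the
    factor at k is the vanishing mean of g. *)
Lemma iid_pair (g : O -> R) (k l : 'I_m) : \sum_x p x * g x = 0 ->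
  \sum_o iid o * (g (o k) * g (o l)) = (k == l)%:R * \sum_x p x * g x ^+ 2.
Proof.
move=> g0.
pose h (i : 'I_m) x := (if i == k then g x else 1) * (if i == l then g x else 1).
transitivity (\prod_i \sum_x p x * h i x).
  rewrite -iid_prod; apply: eq_bigr => o _; congr (_ * _).
  by rewrite /h big_split /= -!big_mkcond /= !big_pred1_eq.
have [kl|nkl] := eqVneq k l.
  rewrite mul1r (bigD1 k) //= [X in _ * X]big1 ?mulr1 => [|i /negPf ik].
    by apply: eq_bigr => x _; rewrite /h -kl eqxx expr2.
  by rewrite -p_sum1; apply: eq_bigr => x _; rewrite /h -kl ik !mulr1.
rewrite mul0r (bigD1 k) //=; apply/eqP; rewrite mulf_eq0; apply/orP; left; apply/eqP.
by rewrite -[RHS]g0; apply: eq_bigr => x _; rewrite /h eqxx (negPf nkl) mulr1.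
Qed.

(** After centring, only the m diagonal terms of the expanded square survive, and a variance is at
    most the second moment. *)
Lemma iid_variance (f : O -> R) : (0 < m)%N ->
  \sum_o iid o * (m%:R^-1 * (\sum_k f (o k)) - \sum_x p x * f x) ^+ 2
    <= m%:R^-1 * \sum_x p x * f x ^+ 2.
Proof.
move=> m0; set e := \sum_x p x * f x; pose g x := f x - e.
have mne : m%:R != 0 :> R by rewrite pnatr_eq0 -lt0n.
have g0 : \sum_x p x * g x = 0.
  under eq_bigr => x _ do rewrite mulrBr.
  by rewrite sumrB -mulr_suml p_sum1 mul1r subrr.
have gf : \sum_x p x * g x ^+ 2 <= \sum_x p x * f x ^+ 2.
  have -> : \sum_x p x * g x ^+ 2 = \sum_x p x * f x ^+ 2 - e ^+ 2.
    rewrite (eq_bigr (fun x => p x * f x ^+ 2 - p x * f x * (2 * e) + p x * e ^+ 2)); last first.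
      by move=> x _; rewrite /g; ring.
    rewrite big_split /= sumrB -!mulr_suml p_sum1 -/e; ring.
  by rewrite gerBl sqr_ge0.
have -> : \sum_o iid o * (m%:R^-1 * (\sum_k f (o k)) - e) ^+ 2
   = m%:R^-1 * \sum_x p x * g x ^+ 2.
  transitivity (\sum_o \sum_k \sum_l m%:R^-2 * (iid o * (g (o k) * g (o l)))).
    apply: eq_bigr => o _.
    have -> : m%:R^-1 * (\sum_k f (o k)) - e = m%:R^-1 * \sum_k g (o k).
      by rewrite /g sumrB sumr_const card_ord -[e *+ m]mulr_natl mulrBr mulKf.
    rewrite exprMn exprVn [(\sum__ _) ^+ 2]expr2 mulr_suml !mulr_sumr.
    apply: eq_bigr => k _.
    rewrite !mulr_sumr; apply: eq_bigr => l _; ring.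
  rewrite exchange_big /=.
  transitivity (\sum_(k < m) m%:R^-2 * \sum_x p x * g x ^+ 2).
    apply: eq_bigr => k _; rewrite exchange_big /=.
    rewrite (eq_bigr (fun l => (k == l)%:R * (m%:R^-2 * \sum_x p x * g x ^+ 2))); last first.
      by move=> l _; rewrite -mulr_sumr iid_pair //; ring.
    by rewrite sum_deltal.
  rewrite sumr_const card_ord -[LHS]mulr_natl mulrA; congr (_ * _).
  by field.
by rewrite ler_wpM2l // invr_ge0 ler0n.
Qed.

Lemma iid_cvariance (f : O -> R[i]) : (0 < m)%N ->
  \sum_o iid o * abs2 ((m%:R^-1)%:C%C * (\sum_k f (o k)) - \sum_x (p x)%:C%C * f x)
    <= m%:R^-1 * \sum_x p x * abs2 (f x).
Proof.
move=> m0; set e := \sum_x (p x)%:C%C * f x.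
have -> : \sum_x p x * abs2 (f x)
    = (\sum_x p x * Re (f x) ^+ 2) + \sum_x p x * Im (f x) ^+ 2.
  by rewrite -big_split; apply: eq_bigr => x _; rewrite abs2E mulrDr.
rewrite mulrDr; apply: le_trans (lerD (iid_variance (fun x => Re (f x)) m0)
                                     (iid_variance (fun x => Im (f x)) m0)).
rewrite -big_split /=; apply: ler_sum => o _; rewrite -mulrDr abs2E.
have -> : \sum_x p x * Re (f x) = Re e.
  by rewrite Re_sum; apply: eq_bigr => x _; rewrite ReMr.
have -> : \sum_x p x * Im (f x) = Im e.
  by rewrite Im_sum; apply: eq_bigr => x _; rewrite ImMr.
by rewrite ReB ImB ReMr ImMr Re_sum Im_sum.
Qed.

End FiniteProbability.

(** Bernoulli's inequality and (1 + x)(1 - x) <= 1 give (1 + m x)(1 - x)^m <= 1. With x the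
    probability that one sample reveals a given qubit, this bounds the weight lost by never seeing
    that qubit, uniformly in x. *)
Lemma mul_exp_miss_le (R : realType) (x : R) (m : nat) : (0 < m)%N ->
  0 <= x <= 1 -> x * (1 - x) ^+ m <= m%:R^-1.
Proof.
move=> m0 /andP[x0 x1].
have mgt : 0 < m%:R :> R by rewrite ltr0n.
have bern : 1 + m%:R * x <= (1 + x) ^+ m.
  elim: (m) => [|j IH]; first by rewrite mul0r addr0 expr0.
  rewrite exprS; apply: (@le_trans _ _ ((1 + x) * (1 + j%:R * x))).
    rewrite -natr1; have : 0 <= j%:R * x ^+ 2 by rewrite mulr_ge0 ?sqr_ge0.
    by rewrite expr2 => h; lra.
  by rewrite ler_wpM2l // addr_ge0.
have y0 : 0 <= (1 - x) ^+ m by rewrite exprn_ge0 // subr_ge0.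
have h : (1 + m%:R * x) * (1 - x) ^+ m <= 1.
  apply: (@le_trans _ _ ((1 + x) ^+ m * (1 - x) ^+ m)); first by rewrite ler_wpM2r.
  rewrite -exprMn exprn_ile1 //; first by rewrite mulr_ge0 ?subr_ge0 ?addr_ge0.
  by rewrite -subr_ge0; have := sqr_ge0 x; rewrite expr2; lra.
rewrite -(ler_pM2l mgt) mulfV ?gt_eqF //; nra.
Qed.

(** Success of an adaptive two-stage experiment: each first outcome in [g1] leaves conditional
    success at least r, and the other first outcomes contribute non-negative terms. *)
Lemma chain_success (R : realType) (O1 O2 : finType) (p1 : O1 -> R)
    (p2 : O1 -> O2 -> R) (g1 : pred O1) (g : pred (O1 * O2)) (q r : R) :
  (forall o, 0 <= p1 o) -> (forall o o', 0 <= p2 o o') -> 0 <= r ->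
  q <= \sum_(o | g1 o) p1 o ->
  (forall o, g1 o -> r <= \sum_(o' | g (o, o')) p2 o o') ->
  q * r <= \sum_(o | g o) p1 o.1 * p2 o.1 o.2.
Proof.
move=> p10 p20 r0 hq hr.
apply: (@le_trans _ _ ((\sum_(o | g1 o) p1 o) * r)); first by rewrite ler_wpM2r.
rewrite mulr_suml.
have -> : \sum_(o | g o) p1 o.1 * p2 o.1 o.2 =
          \sum_o \sum_(o' | g (o, o')) p1 o * p2 o o'.
  by rewrite pair_big_dep /=; apply: eq_big => -[].
rewrite [X in _ <= X](bigID g1) /= -[X in X <= _]addr0; apply: lerD.
  by apply: ler_sum => o go; rewrite -mulr_sumr ler_wpM2l // hr.
by apply: sumr_ge0 => o _; apply: sumr_ge0 => o' _; rewrite mulr_ge0.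
Qed.

(** * Adjoints, isometries and their extension to unitaries *)

Section AdjointMatrices.
Variable R : realType.
Local Notation C := R[i].

Lemma adjmxE m n (A : 'M[C]_(m, n)) i j : adjmx A i j = conjc (A j i).
Proof. by rewrite !mxE. Qed.

Lemma adjmxK m n (A : 'M[C]_(m, n)) : adjmx (adjmx A) = A.
Proof. by apply/matrixP => i j; rewrite !adjmxE conjcK. Qed.

Lemma adjmxM m n p (A : 'M[C]_(m, n)) (B : 'M[C]_(n, p)) :
  adjmx (A *m B) = adjmx B *m adjmx A.
Proof. by rewrite /adjmx map_mxM trmx_mul. Qed.

Lemma adjmxD m n (A B : 'M[C]_(m, n)) : adjmx (A + B) = adjmx A + adjmx B.
Proof. by rewrite /adjmx map_mxD raddfD. Qed.

Lemma adjmxN m n (A : 'M[C]_(m, n)) : adjmx (- A) = - adjmx A.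
Proof. by rewrite /adjmx map_mxN raddfN. Qed.

Lemma adjmx1 n : adjmx (1%:M : 'M[C]_n) = 1%:M.
Proof. by rewrite /adjmx map_mx1 trmx1. Qed.

Lemma adjmx0 m n : adjmx (0 : 'M[C]_(m, n)) = 0.
Proof. by rewrite /adjmx map_mx0 trmx0. Qed.

Lemma unitaryP n (A : 'M[C]_n) : adjmx A *m A = 1%:M -> unitary A.
Proof. by move=> h; split => //; apply: mulmx1C. Qed.

Lemma unitary1 n : unitary (1%:M : 'M[C]_n).
Proof. by apply: unitaryP; rewrite adjmx1 mul1mx. Qed.

Lemma unitaryM n (A B : 'M[C]_n) : unitary A -> unitary B -> unitary (A *m B).
Proof.
move=> [hA _] [hB _]; apply: unitaryP.
by rewrite adjmxM mulmxA -(mulmxA (adjmx B)) hA mulmx1.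
Qed.

(* Exchanges the ranges of two isometries with orthogonal ranges and fixes the
   complement: any isometry becomes part of a unitary without completing a basis. *)
Definition exchange_mx D q (A J : 'M[C]_(D, q)) : 'M[C]_D :=
  A *m adjmx J + J *m adjmx A + (1%:M - A *m adjmx A - J *m adjmx J).

(** The matrix is self-adjoint and swaps A with J, hence squares to the identity. *)
Lemma exchange_mxP D q (A J : 'M[C]_(D, q)) :
  adjmx A *m A = 1%:M -> adjmx J *m J = 1%:M -> adjmx A *m J = 0 ->
  unitary (exchange_mx A J) /\ exchange_mx A J *m J = A.
Proof.
move=> hA hJ hAJ.
have hJA : adjmx J *m A = 0 by rewrite -[A]adjmxK -adjmxM hAJ adjmx0.
have WJ : exchange_mx A J *m J = A.
  rewrite /exchange_mx !(mulmxDl, mulNmx) mul1mx -!mulmxA hJ hAJ !mulmx0 !mulmx1.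
  by rewrite addr0 subr0 subrr addr0.
have WA : exchange_mx A J *m A = J.
  rewrite /exchange_mx !(mulmxDl, mulNmx) mul1mx -!mulmxA hA hJA !mulmx0 !mulmx1.
  by rewrite add0r subr0 subrr addr0.
have Wadj : adjmx (exchange_mx A J) = exchange_mx A J.
  rewrite /exchange_mx !(adjmxD, adjmxN, adjmxM, adjmxK) adjmx1.
  by rewrite (addrC (J *m _)).
split=> //; apply: unitaryP; rewrite Wadj {2}/exchange_mx.
rewrite !(mulmxDr, mulmxN) mulmx1 !mulmxA WA WJ {1}/exchange_mx.
set a := A *m _; set b := J *m _; set c := J *m _; set d := A *m _.
apply/matrixP => i j; rewrite !mxE; ring.
Qed.

(** Serves both as an embedding of a register (c injective) and as a permutation gate (c an
    involution). *)
Definition incl_mx D q (c : 'I_q -> 'I_D) : 'M[C]_(D, q) :=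
  \matrix_(i, j) (i == c j)%:R.

Lemma incl_mx_iso D q (c : 'I_q -> 'I_D) : injective c ->
  adjmx (incl_mx c) *m incl_mx c = 1%:M.
Proof.
move=> cI; apply/matrixP => i j; rewrite !mxE.
under eq_bigr => k _ do rewrite adjmxE !mxE conjc_bool.
by rewrite sum_delta_sym (inj_eq cI).
Qed.

Lemma incl_mx_orth D q r (c : 'I_q -> 'I_D) (c' : 'I_r -> 'I_D) :
  (forall i j, c i != c' j) -> adjmx (incl_mx c) *m incl_mx c' = 0.
Proof.
move=> ne; apply/matrixP => i j; rewrite !mxE.
under eq_bigr => k _ do rewrite adjmxE !mxE conjc_bool.
by rewrite sum_delta_sym (negPf (ne _ _)).
Qed.

Lemma incl_mxM D q r (c : 'I_q -> 'I_D) (M : 'M[C]_(q, r)) i j : injective c ->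
  (incl_mx c *m M) (c i) j = M i j.
Proof.
move=> cI; rewrite mxE; under eq_bigr => k _ do rewrite mxE (inj_eq cI).
by rewrite sum_deltal.
Qed.

Lemma invol_mxP D (s : 'I_D -> 'I_D) : involutive s ->
  unitary (incl_mx s) /\
  forall r (M : 'M[C]_(D, r)) i j, (incl_mx s *m M) i j = M (s i) j.
Proof.
move=> sI; split; first by apply/unitaryP/incl_mx_iso/inv_inj.
by move=> r M i j; rewrite -{1}(sI i) incl_mxM //; apply: inv_inj.
Qed.

End AdjointMatrices.

Arguments incl_mx {R D q} c.
Arguments incl_mx_iso {R D q c}.
Arguments incl_mx_orth {R D q r c c'}.
Arguments invol_mxP {R D s}.

Lemma card_ord_bij (A : finType) d : #|A| = d ->
  exists (f : 'I_d -> A) (g : A -> 'I_d), cancel f g /\ cancel g f.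
Proof.
move=> <-; exists enum_val, enum_rank.
by split; [apply: enum_valK | apply: enum_rankK].
Qed.

(** * A query circuit that prepares copies of a state and measures them *)

Section CopiesCircuit.
Variables (R : realType) (n : nat) (B : finType).
Local Notation C := R[i].
Local Notation N := (2 ^ n)%N.
Local Notation X := ('I_N * B)%type.
Variable phi : X -> C.

(** The state (U (x) I) phi, with B a reference system untouched by the oracle. *)
Definition copy (U : 'M[C]_N) (x : X) : C := \sum_q U x.1 q * phi (q, x.2).

(** The rank-one operators |w_o><w_o| resolve the identity; equivalently, psi -> [amp w psi] is an
    isometry, and outcome o has probability |<w_o, psi>|^2. *)
Definition povm (I O : finType) (w : O -> I -> C) :=
  forall x x', \sum_o w o x * conjc (w o x') = (x == x')%:R.

Definition amp (I O : finType) (w : O -> I -> C) (psi : I -> C) (o : O) : C :=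
  \sum_x conjc (w o x) * psi x.

Definition copies (T : nat) (U : 'M[C]_N) (z : {ffun 'I_T -> X}) : C :=
  \prod_t copy U (z t).

Hypothesis phi_unit : \sum_x abs2 (phi x) = 1.
Variables (T' : nat) (O : finType).
Local Notation T := T'.+1.
Local Notation Z := {ffun 'I_T -> X}.
Variable w : O -> Z -> C.
Hypothesis w_povm : povm w.
Variable out : O -> 'M[C]_N.
Hypothesis out_unitary : forall o, unitary (out o).

(* Besides the T copies, the ancilla holds one bit separating the states reached
   during the run from the initial basis state and from the outcome states, and a
   register whose basis state [set o] records the outcome o. *)
Local Notation Anc := (Z * (bool * {set O}))%type.
Variables (a : nat) (dec : 'I_(2 ^ a) -> Anc) (enc : Anc -> 'I_(2 ^ a)).
Hypothesis decK : cancel dec enc.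
Hypothesis encK : cancel enc dec.
Local Notation D := (N * 2 ^ a)%N.
Local Notation Y := ('I_N * Anc)%type.

Let dY (i : 'I_D) : Y := ((mxtens_unindex i).1, dec (mxtens_unindex i).2).
Let eY (y : Y) : 'I_D := mxtens_index (y.1, enc y.2).

Let dYK : cancel dY eY.
Proof. by move=> i; rewrite /eY /dY [X in (_, enc X)]/= decK; apply: mxtens_unindexK. Qed.

Let eYK : cancel eY dY.
Proof. by move=> [q y]; rewrite /eY /dY mxtens_indexK /= encK. Qed.

Let eY_inj : injective eY := can_inj eYK.

Let colf (f : Y -> C) : 'cV[C]_D := \col_i f (dY i).

Let oracle_colf (U : 'M[C]_N) (f : Y -> C) :
  (U *t (1%:M : 'M[C]_(2 ^ a))) *m colf f
  = colf (fun y => \sum_q U y.1 q * f (q, y.2)).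
Proof.
apply/matrixP => i j; rewrite !mxE.
rewrite (reindex (@mxtens_index N (2 ^ a))) /=; last first.
  by exists (@mxtens_unindex _ _) => k _; [apply: mxtens_indexK|apply: mxtens_unindexK].
transitivity (\sum_q \sum_l
    (U *t 1%:M) i (mxtens_index (q, l)) * colf f (mxtens_index (q, l)) j).
  by rewrite pair_big; apply: eq_bigr => -[].
apply: eq_bigr => q _.
under eq_bigr => l _ do rewrite !mxE /dY mxtens_indexK /= mulrAC.
by rewrite sum_deltar.
Qed.

(** [dec] is an arbitrary bijection, so the initial basis state may decode to anything. Negating its
    flag makes every run index differ from it; outcome indices carry the opposite flag and so differ
    from run indices too. *)
Let b1 := ~~ (dY (zero_idx n a)).2.2.1.
Let q0 := (dY (zero_idx n a)).1.
Let z0 := (dY (zero_idx n a)).2.1.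
Let run_idx (z : Z) : Y := (q0, (z, (b1, finset.set0))).
Let out_idx (o : O) : Y := (q0, (z0, (~~ b1, [set o]%SET))).

Let J : 'M[C]_(D, #|Z|) := incl_mx (fun j => eY (run_idx (enum_val j))).
Let K : 'M[C]_(D, #|O|) := incl_mx (fun j => eY (out_idx (enum_val j))).
Let start : 'M[C]_(D, 1) := incl_mx (fun _ => zero_idx n a).
Let vecZ (f : Z -> C) : 'cV[C]_#|Z| := \col_j f (enum_val j).

Let run_inj : injective (fun j : 'I_#|Z| => eY (run_idx (enum_val j))).
Proof. by move=> i j /eY_inj [] /enum_val_inj. Qed.

Let out_inj : injective (fun j : 'I_#|O| => eY (out_idx (enum_val j))).
Proof. by move=> i j /eY_inj [] /finset.set1_inj /enum_val_inj. Qed.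

Let KJ : adjmx K *m J = 0.
Proof.
apply: incl_mx_orth => i j; apply/eqP => /eY_inj [_].
by case: b1.
Qed.

Let Jstart : adjmx J *m start = 0.
Proof.
apply: incl_mx_orth => i j; apply/eqP => h.
have := eYK (run_idx (enum_val i)); rewrite h => /(congr1 (fun y => y.2.2.1)) /=.
by rewrite /b1; case: (_.2.2.1).
Qed.

Let J_vecZ f : J *m vecZ f =
  colf (fun y => (y.1 == q0)%:R * (y.2.2 == (b1, finset.set0))%:R * f y.2.1).
Proof.
apply/matrixP => i j; rewrite [LHS]mxE [RHS]mxE.
have Ji k : J i k = (dY i == run_idx (enum_val k))%:R.
  by rewrite mxE -(can_eq dYK) eYK.
under eq_bigr => k _ do rewrite Ji mxE.
rewrite (reindex_onto enum_rank enum_val) => [|k _]; last exact: enum_valK.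
under eq_bigl => z do rewrite enum_rankK eqxx.
under eq_bigr => z _ do rewrite enum_rankK.
case: (dY i) => q [z r]; rewrite [_.1]/= [_.2.1]/= [_.2.2]/=.
transitivity (\sum_z' (z == z')%:R * ((q == q0)%:R * (r == (b1, finset.set0))%:R * f z')).
  2: exact: (sum_deltal z (fun z' => (q == q0)%:R * (r == (b1, finset.set0))%:R * f z')).
apply: eq_bigr => z' _; rewrite !mulrA; congr (_ * _).
rewrite -!natrM !mulnb /run_idx 2!xpair_eqE; congr (_%:R); congr nat_of_bool.
by rewrite andbCA andbA.
Qed.

(** Naimark dilation of the measurement: f is sent to the superposition of the outcome states with
    amplitudes <w_o, f>. It is isometric because w resolves the identity. *)
Let Am : 'M[C]_(D, #|Z|) :=
  K *m (\matrix_(i, j) conjc (w (enum_val i) (enum_val j))).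

Let Am_iso : adjmx Am *m Am = 1%:M.
Proof.
rewrite adjmxM mulmxA -(mulmxA (adjmx _)) incl_mx_iso // mulmx1.
apply/matrixP => i j; rewrite !mxE.
under eq_bigr => k _ do rewrite adjmxE !mxE conjcK.
rewrite (reindex enum_rank) /=; last first.
  by exists enum_val => k _; [apply: enum_rankK|apply: enum_valK].
under eq_bigr => k _ do rewrite enum_rankK.
by rewrite w_povm (inj_eq enum_val_inj).
Qed.

Let AmJ : adjmx Am *m J = 0.
Proof. by rewrite adjmxM -mulmxA KJ mulmx0. Qed.

(** The product state after t queries: the first t copies are finished, the others are still phi. *)
Let prefix_state (U : 'M[C]_N) (t : nat) (z : Z) : C :=
  \prod_(s < T) (if (s < t)%N then copy U (z s) else phi (z s)).

Let vec0 := J *m vecZ (prefix_state 0 0).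

Let vec0_iso : adjmx vec0 *m vec0 = 1%:M.
Proof.
rewrite adjmxM mulmxA -(mulmxA (adjmx _)) incl_mx_iso // mulmx1.
apply/matrixP => i j; rewrite !ord1 !mxE eqxx.
under eq_bigr => k _ do rewrite adjmxE !mxE -abs2C.
rewrite (reindex enum_rank) /=; last first.
  by exists enum_val => k _; [apply: enum_rankK|apply: enum_valK].
under eq_bigr => k _ do rewrite enum_rankK /prefix_state abs2_prod /=.
rewrite -(rmorph_sum (real_complex R)) /=.
rewrite -(bigA_distr_bigA (fun (s : 'I_T) x => abs2 (phi x))) /=.
by rewrite big1 // => s _; rewrite phi_unit.
Qed.

Let vec0_start : adjmx vec0 *m start = 0.
Proof. by rewrite adjmxM -mulmxA Jstart mulmx0. Qed.

Let put (z : Z) (t : 'I_T) (q : 'I_N) : Z :=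
  [ffun s => if s == t then (q, (z t).2) else z s].

(** Swaps the oracle register with the n-qubit register of copy t, since the oracle acts on its own
    register only. *)
Let sw (t : nat) (y : Y) : Y :=
  let t' : 'I_T := inord t in ((y.2.1 t').1, (put y.2.1 t' y.1, y.2.2)).

Let sw_invol t : involutive (sw t).
Proof.
move=> [q [z r]]; rewrite /sw /= ffunE eqxx /=; congr (_, (_, _)).
apply/ffunP => s; rewrite !ffunE; case: eqP => [->|//].
by rewrite eqxx /= -surjective_pairing.
Qed.

Let swI t (i : 'I_D) := eY (sw t (dY i)).
Let swI_invol t : involutive (swI t).
Proof. by move=> i; rewrite /swI eYK sw_invol dYK. Qed.

Let S t : 'M[C]_D := incl_mx (swI t).

Let S_colf t f : S t *m colf f = colf (fun y => f (sw t y)).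
Proof.
apply/matrixP => i j; rewrite (invol_mxP (@swI_invol t)).2 !mxE.
by rewrite /swI eYK.
Qed.

Let put_step (U : 'M[C]_N) t (z : Z) q : (t < T)%N ->
  \sum_q' U q q' * prefix_state U t (put z (inord t) q')
  = prefix_state U t.+1 (put z (inord t) q).
Proof.
move=> tT; set t' : 'I_T := inord t.
have tt : t' = t :> nat by rewrite inordK.
rewrite /prefix_state (bigD1 t') //= tt ltnSn ffunE eqxx /copy mulr_suml.
apply: eq_bigr => q' _; rewrite (bigD1 t') //= tt ltnn ffunE eqxx -mulrA.
congr (_ * (_ * _)); apply: eq_bigr => s st.
rewrite !ffunE (negPf st); congr (if _ then _ else _).
by rewrite ltnS [RHS]leq_eqVlt -[t in s == t :> nat]tt val_eqE (negPf st).
Qed.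

Let step (U : 'M[C]_N) t : (t < T)%N ->
  S t *m ((U *t (1%:M : 'M[C]_(2 ^ a))) *m (S t *m (J *m vecZ (prefix_state U t))))
  = J *m vecZ (prefix_state U t.+1).
Proof.
move=> tT; rewrite !J_vecZ S_colf oracle_colf S_colf; congr colf.
apply/funext => -[q [z r]] /=; rewrite !ffunE eqxx /=.
under eq_bigr => q' _.
  have -> : put (put z (inord t) q) (inord t) q' = put z (inord t) q'.
    by apply/ffunP => s; rewrite !ffunE eqxx /=; case: eqP.
  rewrite mulrCA; over.
rewrite -mulr_sumr put_step //; congr (_ * _ * prefix_state _ _ _).
by apply/ffunP => s; rewrite ffunE; case: eqP => [->|//]; rewrite -surjective_pairing.
Qed.

(** Gate t swaps copy t - 1 back and copy t in. The first gate prepares the product of the phi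
    instead of swapping back; the last one performs the dilated measurement instead of swapping
    in. *)
Let G (t : nat) : 'M[C]_D :=
  (if (t < T)%N then S t else exchange_mx Am J) *m
  (if t is t'.+1 then S t' else exchange_mx vec0 start).

Let G_unitary t : unitary (G t).
Proof.
have SU s : unitary (S s) := (invol_mxP (@swI_invol s)).1.
apply: unitaryM; first case: ifP => _ //.
  by apply: (exchange_mxP _ _ _).1 => //; apply: incl_mx_iso.
case: t => [|t] //; apply: (exchange_mxP _ _ _).1 => //.
by apply: incl_mx_iso => i j; rewrite !ord1.
Qed.

Let outA (i : 'I_D) : 'M[C]_N :=
  (* Registers that hold no singleton get the identity, an arbitrary unitary. *)
  if [pick o | (dY i).2.2.2 == [set o]%SET] is Some o then out o else 1%:M.

Let outA_unitary i : unitary (outA i).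
Proof. by rewrite /outA; case: pickP => // _; apply: unitary1. Qed.

Let alg := QueryAlg T G_unitary outA_unitary.

Let run_alg (U : 'M[C]_N) t : (t <= T)%N -> run_state alg U t =
  (if (t < T)%N then S t else exchange_mx Am J) *m (J *m vecZ (prefix_state U t)).
Proof.
elim: t => [_|t IH tT] /=.
  rewrite /G /= -mulmxA; congr (_ *m _).
  have -> : delta_mx (zero_idx n a) 0 = start.
    by apply/matrixP => i j; rewrite !mxE ord1 eqxx andbT.
  have sI : adjmx start *m start = 1%:M by apply: incl_mx_iso => i j; rewrite !ord1.
  rewrite (exchange_mxP vec0_iso sI vec0_start).2.
  by rewrite /vec0; congr (J *m vecZ _); apply/funext => z; apply: eq_bigr.
rewrite (IH (ltnW tT)) tT -(step U tT).
by symmetry; apply: mulmxA.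
Qed.

(** Distinct outcomes o sit on distinct basis states, with final amplitude <w_o, copies>. The
    remaining basis states can only add to the success probability, whence an inequality. *)
Lemma circuit_from_bij : exists A : query_alg R n,
  nqueries A = T /\ forall U eps,
  \sum_(o | qdist U (out o) <= eps) abs2 (amp w (@copies T U) o)
    <= success_prob A U eps.
Proof.
exists alg; split=> // U eps.
have fin o : final_state alg U (eY (out_idx o)) 0 = amp w (@copies T U) o.
  rewrite /final_state run_alg // ltnn mulmxA.
  rewrite (exchange_mxP Am_iso (incl_mx_iso run_inj) AmJ).2.
  rewrite -mulmxA -[o in LHS](enum_rankK) incl_mxM // mxE.
  rewrite (reindex enum_rank) /=; last first.
    by exists enum_val => k _; [apply: enum_rankK|apply: enum_valK].
  apply: eq_bigr => z _; rewrite !mxE !enum_rankK; congr (_ * _).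
  by apply: eq_bigr => s _; rewrite ltn_ord.
have outo o : outA (eY (out_idx o)) = out o.
  rewrite /outA eYK /=; case: pickP => [o' /eqP/finset.set1_inj -> //|/(_ o)].
  by rewrite eqxx.
have inj : injective (fun o => eY (out_idx o)) by move=> o o' /eY_inj [] /finset.set1_inj.
rewrite /success_prob.
rewrite (bigID (fun i => i \in [set eY (out_idx o) | o : O]%SET)) /=.
rewrite -[X in X <= _]addr0 lerD //; last first.
  by apply: sumr_ge0 => i _; apply: abs2_ge0.
rewrite le_eqVlt; apply/orP; left; apply/eqP.
under [RHS]eq_bigl => i do rewrite andbC.
rewrite [RHS]big_mkcondr /=.
rewrite [RHS]big_imset /=; last by move=> o o' _ _; apply: inj.
rewrite big_mkcond; apply: eq_bigr => o _.
by rewrite outo -/(abs2 _) fin.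
Qed.

End CopiesCircuit.

Lemma copies_circuit (R : realType) (n b : nat) (B : finType)
    (phi : 'I_(2 ^ n) * B -> R[i]) (T : nat) (O : finType)
    (w : O -> {ffun 'I_T -> 'I_(2 ^ n) * B} -> R[i]) (out : O -> 'M[R[i]]_(2 ^ n)) :
  #|B| = (2 ^ b)%N -> \sum_x abs2 (phi x) = 1 -> (0 < T)%N -> povm w ->
  (forall o, unitary (out o)) ->
  exists A : query_alg R n, nqueries A = T /\ forall U eps,
    \sum_(o | qdist U (out o) <= eps) abs2 (amp w (copies phi (T:=T) U) o)
      <= success_prob A U eps.
Proof.
case: T w => // T w cB hphi _ hw hout.
(* One qubit per bit of the copies, #|O| qubits for the outcome register and one for the flag.
   Recording outcomes as subsets of O makes the size of the ancilla exactly a power of two. *)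
pose a := ((n + b) * T.+1 + #|O|.+1)%N.
have cA : #|{: {ffun 'I_T.+1 -> 'I_(2 ^ n) * B} * (bool * {set O})}| = (2 ^ a)%N.
  rewrite !card_prod card_ffun card_prod !card_ord cB card_bool.
  rewrite -expnD -expnM expnD expnS; congr (_ * (_ * _))%N.
  by rewrite -cardsT -powersetT card_powerset cardsT.
have [dec [enc [decK encK]]] := card_ord_bij cA.
exact: (circuit_from_bij hphi hw hout decK encK).
Qed.

(** * Composition of measurements: change of basis, products, adaptivity *)

Section Measurements.
Variable R : realType.
Local Notation C := R[i].

Lemma povm_norm (I O : finType) (w : O -> I -> C) (psi : I -> C) : povm w ->
  \sum_o abs2 (amp w psi o) = \sum_i abs2 (psi i).
Proof.
move=> hw; apply: (@complexI R).
rewrite !(rmorph_sum (real_complex R)) /=.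
transitivity (\sum_o \sum_i \sum_j
    conjc (conjc (w o i) * psi i) * (conjc (w o j) * psi j)).
  apply: eq_bigr => o _; rewrite abs2C /amp conjc_sum mulr_suml.
  by apply: eq_bigr => i _; rewrite mulr_sumr.
rewrite exchange_big /=; apply: eq_bigr => i _; rewrite exchange_big /=.
rewrite abs2C -(sum_deltal i (fun j => conjc (psi i) * psi j)).
apply: eq_bigr => j _; rewrite -hw mulr_suml; apply: eq_bigr => o _.
by rewrite conjcM conjcK; ring.
Qed.

Lemma povm_comp (X I O : finType) (E : I -> X -> C) (v : O -> I -> C) :
  povm E -> povm v -> povm (fun o x => \sum_i v o i * E i x).
Proof.
move=> hE hv x x'; under eq_bigr => o _ do rewrite conjc_sum mulr_suml.
rewrite exchange_big /= -hE; apply: eq_bigr => i _.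
under eq_bigr => o _ do rewrite mulr_sumr.
rewrite exchange_big /= -(sum_deltal i (fun j => E i x * conjc (E j x'))).
apply: eq_bigr => j _; rewrite -hv mulr_suml; apply: eq_bigr => o _.
by rewrite conjcM; ring.
Qed.

Lemma amp_comp (X I O : finType) (E : I -> X -> C) (v : O -> I -> C) psi o :
  amp (fun o x => \sum_i v o i * E i x) psi o = amp v (amp E psi) o.
Proof.
rewrite /amp; under eq_bigr => x _ do rewrite conjc_sum mulr_suml.
rewrite exchange_big /=; apply: eq_bigr => i _; rewrite mulr_sumr.
by apply: eq_bigr => x _; rewrite conjcM mulrA.
Qed.

Lemma povm_prod (X O : finType) (m : nat) (v : O -> X -> C) : povm v ->
  povm (fun (o : {ffun 'I_m -> O}) (z : {ffun 'I_m -> X}) => \prod_k v (o k) (z k)).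
Proof.
move=> hv z z'; under eq_bigr => o _ do rewrite conjc_prod -big_split /=.
rewrite -(bigA_distr_bigA (fun k o => v o (z k) * conjc (v o (z' k)))) /=.
under eq_bigr => k _ do rewrite hv.
case: eqP => [->|/eqP ne]; first by rewrite big1 // => k _; rewrite eqxx.
have [k /eqP nk] : exists k, z k <> z' k.
  by apply/existsNP => h; move/eqP: ne; apply; apply/ffunP.
by rewrite (bigD1 k) //= (negPf nk) mul0r.
Qed.

Lemma amp_prod (X O : finType) (m : nat) (v : O -> X -> C) psi (o : {ffun 'I_m -> O}) :
  amp (fun (o : {ffun 'I_m -> O}) (z : {ffun 'I_m -> X}) => \prod_k v (o k) (z k))
      (fun z => \prod_k psi (z k)) o = \prod_k amp v psi (o k).
Proof.
rewrite /amp bigA_distr_bigA /=; apply: eq_bigr => z _.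
by rewrite conjc_prod big_split.
Qed.

Variables (n : nat) (B : finType) (phi : 'I_(2 ^ n) * B -> C).
Local Notation X := ('I_(2 ^ n) * B)%type.

(** The vectors w are chosen before U, so the distribution comes from one fixed measurement of T
    copies of the unknown state. *)
Definition samplable (T : nat) (O : finType) (P : 'M[C]_(2 ^ n) -> O -> R) :=
  exists2 w : O -> {ffun 'I_T -> X} -> C, povm w &
    forall U o, P U o = abs2 (amp w (copies phi (T:=T) U) o).

Lemma samplable_iid (I O : finType) (m : nat) (E : I -> X -> C) (v : O -> I -> C) :
  povm E -> povm v ->
  samplable m (fun U => iid (fun x => abs2 (amp v (amp E (copy phi U)) x)) (m:=m)).
Proof.
move=> hE hv; exists (fun (o : {ffun 'I_m -> O}) (z : {ffun 'I_m -> X}) =>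
  \prod_k \sum_i v (o k) i * E i (z k)).
  exact: povm_prod (povm_comp hE hv).
move=> U o; rewrite /copies (amp_prod (fun o x => \sum_i v o i * E i x)) abs2_prod.
by apply: eq_bigr => k _; rewrite amp_comp.
Qed.

(** Deferred measurement: the vectors w1_{o1} (x) w2_{o1,o2} still resolve the identity, because for
    each o1 the sum over o2 can be done first. *)
Lemma samplable_bind (O1 O2 : finType) (T1 T2 : nat)
    (P1 : 'M[C]_(2 ^ n) -> O1 -> R) (P2 : O1 -> 'M[C]_(2 ^ n) -> O2 -> R) :
  samplable T1 P1 -> (forall o1, samplable T2 (P2 o1)) ->
  samplable (T1 + T2) (fun U (o : O1 * O2) => P1 U o.1 * P2 o.1 U o.2).
Proof.
move=> [w1 hw1 hP1] h2.
have /choice[w2 hw2] : forall o1, exists w, povm w /\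
    forall U o, P2 o1 U o = abs2 (amp w (copies phi (T:=T2) U) o).
  by move=> o1; have [w ? ?] := h2 o1; exists w.
pose lft (z : {ffun 'I_(T1 + T2) -> X}) : {ffun 'I_T1 -> X} := [ffun i => z (lshift _ i)].
pose rgt (z : {ffun 'I_(T1 + T2) -> X}) : {ffun 'I_T2 -> X} := [ffun i => z (rshift _ i)].
pose join (zz : {ffun 'I_T1 -> X} * {ffun 'I_T2 -> X}) : {ffun 'I_(T1 + T2) -> X} :=
  [ffun i => match split i with inl j => zz.1 j | inr j => zz.2 j end].
have jl zz : lft (join zz) = zz.1.
  by apply/ffunP => i; rewrite !ffunE -[lshift _ i]/(unsplit (inl i)) unsplitK.
have jr zz : rgt (join zz) = zz.2.
  by apply/ffunP => i; rewrite !ffunE -[rshift _ i]/(unsplit (inr i)) unsplitK.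
have jK z : join (lft z, rgt z) = z.
  apply/ffunP => i; rewrite ffunE -[in RHS](splitK i).
  by case: (split i) => j; rewrite ffunE.
exists (fun o z => w1 o.1 (lft z) * w2 o.1 o.2 (rgt z)).
  move=> z z'.
  rewrite -(pair_big xpredT xpredT (fun o1 o2 => w1 o1 (lft z) * w2 o1 o2 (rgt z) *
     conjc (w1 o1 (lft z') * w2 o1 o2 (rgt z')))) /=.
  transitivity ((lft z == lft z')%:R * (rgt z == rgt z')%:R : C).
    rewrite -hw1 mulr_suml; apply: eq_bigr => o1 _.
    rewrite -(hw2 o1).1 mulr_sumr; apply: eq_bigr => o2 _.
    by rewrite conjcM; ring.
  rewrite -natrM mulnb -(can_eq (g := join) (f := fun z => (lft z, rgt z)) jK).
  by rewrite xpair_eqE.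
move=> U [o1 o2] /=; rewrite hP1 (hw2 o1).2 -abs2M; congr abs2.
rewrite /amp (reindex join) /=; last first.
  exists (fun z => (lft z, rgt z)) => z _; last exact: jK.
  by rewrite jl jr -surjective_pairing.
under [RHS]eq_bigr => zz _ do rewrite jl jr conjcM.
transitivity (\sum_z1 \sum_z2 conjc (w1 o1 z1) * copies phi U z1 *
    (conjc (w2 o1 o2 z2) * copies phi U z2)).
  by rewrite mulr_suml; apply: eq_bigr => z1 _; rewrite mulr_sumr.
rewrite pair_big /=; apply: eq_bigr => -[z1 z2] _ /=.
suff -> : copies phi U (join (z1, z2)) = copies phi U z1 * copies phi U z2 by ring.
rewrite /copies big_split_ord /=; congr (_ * _); apply: eq_bigr => t _.
  by have := jl (z1, z2) => /ffunP/(_ t); rewrite ffunE => ->.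
by have := jr (z1, z2) => /ffunP/(_ t); rewrite ffunE => ->.
Qed.

End Measurements.

(** * Bit vectors as labels of the computational basis *)

Notation bitvec n := {ffun 'I_n -> bool}.

Definition bits_of n (x : 'I_(2 ^ n)) : bitvec n := [ffun i => qbit x i].

Definition of_bits n (b : bitvec n) : 'I_(2 ^ n) := ordmod n (\sum_j b j * 2 ^ j).

Definition bxor n (x y : bitvec n) : bitvec n := [ffun i => x i (+) y i].

Lemma binary_expansion k r : (r < 2 ^ k)%N ->
  (\sum_(j < k) odd (r %/ 2 ^ j) * 2 ^ j)%N = r.
Proof.
elim: k r => [|k IH] r; first by rewrite ltnS leqn0 big_ord0 => /eqP ->.
move=> hr; rewrite big_ord_recl /= divn1 muln1.
under eq_bigr => j _ do rewrite /bump /= add1n expnS divnMA mulnCA.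
rewrite -big_distrr /= IH ?divn2 ?mul2n ?odd_double_half //.
by rewrite -divn2 ltn_divLR // mulnC -expnS.
Qed.

Lemma bits_ofK n : cancel (@bits_of n) (@of_bits n).
Proof.
move=> x; apply: val_inj => /=.
under eq_bigr => j _ do rewrite ffunE.
by rewrite binary_expansion // modn_small.
Qed.

Lemma of_bitsK n : cancel (@of_bits n) (@bits_of n).
Proof.
have bij : bijective (@bits_of n).
  apply: inj_card_bij; first exact: can_inj (@bits_ofK n).
  by rewrite card_ffun card_bool !card_ord.
by apply/(bij_can_sym bij); apply: bits_ofK.
Qed.

Lemma qbit_of_bits n (b : bitvec n) i : qbit (of_bits b) i = b i.
Proof. by rewrite -[in RHS](of_bitsK b) ffunE. Qed.

Lemma sum_of_bits (A : nmodType) n (F : 'I_(2 ^ n) -> A) :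
  \sum_x F x = \sum_b F (of_bits b).
Proof.
rewrite (reindex (@of_bits n)) //.
by exists (@bits_of n) => b _; [apply: of_bitsK | apply: bits_ofK].
Qed.

Lemma bxorK n (y : bitvec n) : involutive (fun x => bxor x y).
Proof. by move=> x; apply/ffunP => i; rewrite !ffunE addbK. Qed.

(** * Juntas in terms of their matrix entries *)

Section JuntaStructure.
Variables (R : realType) (n : nat).
Local Notation C := R[i].

Definition entry (U : 'M[C]_(2 ^ n)) (x y : bitvec n) : C := U (of_bits x) (of_bits y).

(** The consequences of U = V (x) I that the learner relies on, free of V. The vanishing of entries
    controls bit flips off S, the translation invariance controls phase flips off S. *)
Record junta_on (S : {set 'I_n}) (U : 'M[C]_(2 ^ n)) : Prop := JuntaOn {
  junta_on_unitary : unitary U;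
  junta_on_off : forall x y i, entry U x y != 0 -> i \notin S -> x i = y i;
  junta_on_shift : forall e x y : bitvec n, (forall i, i \in S -> e i = false) ->
    entry U (bxor x e) (bxor y e) = entry U x y
}.

Variable S : {set 'I_n}.

Let restr (x : bitvec n) : bitvec #|S| := [ffun j => x (enum_val j)].

Let restr_idxE x : restr_idx #|S| S (of_bits x) = of_bits (restr x).
Proof.
rewrite /restr_idx [RHS]/of_bits; congr ordmod.
rewrite big_enum /= big_enum_val /=; apply: eq_bigr => j _.
rewrite qbit_of_bits ffunE; congr (_ * 2 ^ _)%N.
by rewrite (enum_val_nth (enum_val j)) index_uniq ?enum_uniq // -cardE.
Qed.

Let off (x y : bitvec n) := [forall i in ~: S, x i == y i].

Let junta_entry V x y : entry (junta_mx S V) x y =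
  if off x y then V (of_bits (restr x)) (of_bits (restr y)) else 0.
Proof.
rewrite /entry mxE !restr_idxE; congr (if _ then _ else _).
by apply: eq_forallb => i; rewrite !qbit_of_bits.
Qed.

(** Overwrites y on S by b: the inverse of restriction on the vectors agreeing with y off S. *)
Let ext (y : bitvec n) (b : bitvec #|S|) : bitvec n :=
  [ffun i => if [pick j | enum_val j == i] is Some j then b j else y i].

Let restr_ext y b : restr (ext y b) = b.
Proof.
apply/ffunP => j; rewrite !ffunE; case: pickP => [l /eqP/enum_val_inj -> //|/(_ j)].
by rewrite eqxx.
Qed.

Let off_ext y b : off (ext y b) y.
Proof.
apply/forall_inP => i; rewrite inE => iS; rewrite ffunE.
case: pickP => [j /eqP ji|//]; by rewrite -ji enum_valP in iS.
Qed.

Let ext_restr y x : off x y -> ext y (restr x) = x.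
Proof.
move=> /forall_inP h; apply/ffunP => i; rewrite ffunE.
case: pickP => [j /eqP <-|no]; first by rewrite ffunE.
apply/esym/eqP/h; rewrite inE; apply/negP => iS.
by have := no (enum_rank_in iS i); rewrite enum_rankK_in // eqxx.
Qed.

Lemma junta_mxP V : unitary V -> junta_on S (junta_mx (k:=#|S|) S V).
Proof.
move=> [hV _]; split.
- apply: unitaryP; apply/matrixP => i j; rewrite !mxE.
  rewrite -(bits_ofK i) -(bits_ofK j); move: (bits_of i) (bits_of j) => y y'.
  rewrite (can_eq (@of_bitsK n)) sum_of_bits.
  under eq_bigr => x _.
    rewrite adjmxE -/(entry (junta_mx S V) x y) -/(entry (junta_mx S V) x y').
    rewrite !junta_entry; over.
  transitivity (\sum_(x | off x y) conjc (V (of_bits (restr x)) (of_bits (restr y))) *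
      (if off x y' then V (of_bits (restr x)) (of_bits (restr y')) else 0)).
    rewrite [RHS]big_mkcond; apply: eq_bigr => x _.
    by case: ifP => // _; rewrite conjc0 mul0r.
  (* If y and y' differ off S, no x agrees with both there. Otherwise the x concerned are
     parametrised by their restriction to S, and the sum is an entry of V^* V. *)
  have [oyy|noyy] := boolP (off y y'); last first.
    rewrite big1 => [|x oxy]; last first.
      rewrite ifN ?mulr0 //; apply: contra noyy => /forall_inP oxy'.
      apply/forall_inP => l lS; move/forall_inP: oxy => /(_ l lS) /eqP <-.
      exact: oxy'.
    case: eqP => // yy; case/negP: noyy; rewrite yy.
    by apply/forall_inP => l _.
  rewrite (reindex_onto (ext y) restr) /= => [|x]; last exact: ext_restr.
  under eq_bigl => b do rewrite restr_ext off_ext eqxx.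
  under eq_bigr => b _ do rewrite restr_ext.
  transitivity (\sum_b conjc (V (of_bits b) (of_bits (restr y))) *
                       V (of_bits b) (of_bits (restr y'))).
    apply: eq_bigr => b _; rewrite ifT //; apply/forall_inP => l lS.
    move/forall_inP: (off_ext y b) => /(_ l lS) /eqP ->.
    by move/forall_inP: oyy => /(_ l lS).
  rewrite -(sum_of_bits (fun r => conjc (V r _) * V r _)).
  have := congr1 (fun M : 'M_ _ => M (of_bits (restr y)) (of_bits (restr y'))) hV.
  rewrite !mxE; under eq_bigr => r _ do rewrite adjmxE.
  move=> ->; congr (_%:R); congr nat_of_bool; rewrite (can_eq (@of_bitsK _)).
  apply/eqP/eqP => [h|-> //].
  by rewrite -[LHS](ext_restr oyy) h ext_restr //; apply/forall_inP.
- move=> x y i; rewrite junta_entry; case: ifP => [/forall_inP h _ iS|]; last by rewrite eqxx.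
  by apply/eqP/h; rewrite inE.
- move=> e x y he; rewrite !junta_entry.
  have re z : restr (bxor z e) = restr z.
    by apply/ffunP => j; rewrite !ffunE he ?addbF // enum_valP.
  rewrite !re; congr (if _ then _ else _); apply: eq_forallb => i.
  by rewrite !ffunE; case: (x i); case: (y i); case: (e i).
Qed.

End JuntaStructure.

Lemma is_juntaP (R : realType) n k (U : 'M[R[i]]_(2 ^ n)) : is_junta k U ->
  exists S : {set 'I_n}, #|S| = k /\ junta_on S U.
Proof.
by case=> S [<- [V [hV ->]]]; exists S; split=> //; apply: junta_mxP.
Qed.

(** * The probe state and its coordinates in the Pauli and computational bases *)

Section ProbeState.
Variables (R : realType) (n : nat).
Local Notation C := R[i].
Local Notation N := (2 ^ n)%N.
Local Notation Bv := (bitvec n).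

Definition zerov : Bv := [ffun=> false].

(** The character (-1)^(r.y) of the group of bit vectors. *)
Definition chi (r y : Bv) : R := \prod_i (if r i && y i then -1 else 1).

Lemma chi_orth (y y' : Bv) : \sum_r chi r y * chi r y' = N%:R * (y == y')%:R.
Proof.
under eq_bigr => r _ do rewrite /chi -big_split /=.
pose g (i : 'I_n) (b : bool) : R :=
  (if b && y i then -1 else 1) * (if b && y' i then -1 else 1).
rewrite -(bigA_distr_bigA g) /=.
have gE i : \sum_b g i b = 2 * (y i == y' i)%:R.
  by rewrite big_bool /g /=; case: (y i); case: (y' i) => /=; ring.
under eq_bigr => i _ do rewrite gE.
case: eqP => [->|/eqP ne].
  under eq_bigr => i _ do rewrite eqxx mulr1.
  by rewrite prodr_const card_ord mulr1 natrX.
have [i /eqP nk] : exists i, y i <> y' i.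
  by apply/existsNP => h; move/eqP: ne; apply; apply/ffunP.
by rewrite (bigD1 i) //= (negPf nk) !mulr0 mul0r.
Qed.

Lemma chi_flip (r y : Bv) i : r i -> chi r (bxor y [ffun j => j == i]) = - chi r y.
Proof.
move=> ri; rewrite /chi (bigD1 i) //= [in RHS](bigD1 i) //= !ffunE eqxx ri /=.
rewrite -mulNr; congr (_ * _); first by case: (y i); rewrite /= ?opprK.
by apply: eq_bigr => j /negPf ji; rewrite !ffunE ji addbF.
Qed.

Definition isqrtN : R := (Num.sqrt N%:R)^-1.

Lemma N_gt0 : 0 < N%:R :> R.
Proof. by rewrite ltr0n expn_gt0. Qed.

Lemma isqrtN2 : isqrtN ^+ 2 = N%:R^-1.
Proof. by rewrite /isqrtN exprVn sqr_sqrtr // ltW // N_gt0. Qed.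

Definition comp_basis (pr : Bv * Bv) (x : 'I_N * Bv) : C :=
  (bits_of x.1 == pr.1)%:R * (x.2 == pr.2)%:R.

(* The vectors (X^p Z^r (x) I) applied to the maximally entangled state. *)
Definition pauli_basis (pr : Bv * Bv) (x : 'I_N * Bv) : C :=
  (bits_of x.1 == bxor x.2 pr.1)%:R * (chi pr.2 x.2 * isqrtN)%:C%C.

Lemma comp_basis_povm : povm comp_basis.
Proof.
move=> [q y] [q' y']; rewrite /comp_basis /=.
transitivity (\sum_(p : Bv) \sum_(r : Bv) ((bits_of q == p)%:R * ((bits_of q' == p)%:R *
    ((y == r)%:R * (y' == r)%:R))) : C).
  rewrite pair_big; apply: eq_bigr => -[p r] _ /=.
  by rewrite conjcM !conjc_bool; ring.
under eq_bigr => p _ do rewrite -!mulr_sumr sum_deltal.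
rewrite sum_deltal -natrM mulnb xpair_eqE (can_eq (@bits_ofK n)).
by rewrite (eq_sym y') (eq_sym q').
Qed.

Lemma pauli_basis_povm : povm pauli_basis.
Proof.
move=> [q y] [q' y']; rewrite /pauli_basis /=.
transitivity (\sum_(p : Bv) \sum_(r : Bv) ((bits_of q == bxor y p)%:R * ((bits_of q' == bxor y' p)%:R *
    ((chi r y * chi r y')%:C%C * (isqrtN ^+ 2)%:C%C))) : C).
  rewrite pair_big; apply: eq_bigr => -[p r] _ /=.
  rewrite conjcM !conjc_bool conjc_real expr2 !(rmorphM (real_complex R)) /=; ring.
under eq_bigr => p _ do rewrite -!mulr_sumr -mulr_suml.
under eq_bigr => p _ do
  rewrite -(rmorph_sum (real_complex R)) chi_orth -(rmorphM (real_complex R)) /=.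
have -> : N%:R * (y == y')%:R * isqrtN ^+ 2 = (y == y')%:R.
  by rewrite isqrtN2 mulrAC mulfV ?mul1r // gt_eqF ?N_gt0.
rewrite xpair_eqE; have [<-|ne] := eqVneq y y'; last first.
  by rewrite andbF big1 // => p _; rewrite !mulr0.
have bx p : (bits_of q == bxor y p) = (bxor (bits_of q) y == p).
  apply/eqP/eqP => [->|<-]; apply/ffunP => i; rewrite !ffunE.
    by case: (y i); case: (p i).
  by case: (y i); case: (bits_of q i); case: (qbit q i).
under eq_bigr => p _ do rewrite bx.
rewrite sum_deltal mulr1 andbT; congr (_%:R); congr nat_of_bool.
apply/eqP/eqP => [h|->].
  rewrite -[RHS]bits_ofK h -[LHS]bits_ofK; congr of_bits; apply/ffunP => i.
  by rewrite !ffunE; case: (y i); case: (qbit q i).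
by apply/ffunP => i; rewrite !ffunE; case: (y i); case: (qbit q' i).
Qed.

Local Notation Br := (bool * bool)%type.
(** Branches (false, d) hold two copies of U|0>: d = false carries the reference vector and d = true
    the coordinates to be estimated, so the two never overlap. Branch (true, true) has amplitude
    zero and pads the label to two qubits. *)
Definition pauli_branch : Br := (true, false).

Definition branch_basis (br : Br) := if br == pauli_branch then pauli_basis else comp_basis.

Lemma branch_basis_povm br : povm (branch_basis br).
Proof.
by rewrite /branch_basis; case: ifP => _; [apply: pauli_basis_povm|apply: comp_basis_povm].
Qed.

Local Notation I := (Br * (Bv * Bv))%type.
Local Notation X := ('I_N * (Br * Bv))%type.

Definition probe_basis (i : I) (x : X) : C :=
  (i.1 == x.2.1)%:R * branch_basis i.1 i.2 (x.1, x.2.2).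

Lemma probe_basis_povm : povm probe_basis.
Proof.
move=> [q [br y]] [q' [br' y']]; rewrite /probe_basis /=.
transitivity (\sum_(c : Br) ((c == br)%:R * ((c == br')%:R * \sum_pr
    branch_basis c pr (q, y) * conjc (branch_basis c pr (q', y')))) : C).
  under [RHS]eq_bigr => c _ do rewrite !mulr_sumr.
  rewrite pair_big; apply: eq_bigr => -[c pr] _ /=.
  by rewrite conjcM conjc_bool; ring.
rewrite sum_delta_sym branch_basis_povm -natrM mulnb !xpair_eqE.
by rewrite andbCA.
Qed.

Lemma amp_probe (psi : X -> C) br pr :
  amp probe_basis psi (br, pr) =
  amp (branch_basis br) (fun z : 'I_N * Bv => psi (z.1, (br, z.2))) pr.
Proof.
rewrite /amp /probe_basis /=.
transitivity (\sum_(c : Br) (br == c)%:R * \sum_(z : 'I_N * Bv)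
    (conjc (branch_basis br pr (z.1, z.2)) * psi (z.1, (c, z.2)))).
  under [RHS]eq_bigr => c _ do rewrite mulr_sumr.
  rewrite pair_big.
  rewrite (reindex (fun cz : Br * ('I_N * Bv) => (cz.2.1, (cz.1, cz.2.2)))) /=; last first.
    by exists (fun x : X => (x.2.1, (x.1, x.2.2))) => [[? []]|[? []]].
  apply: eq_bigr => -[c z] _ /=.
  by rewrite conjcM conjc_bool; ring.
by rewrite sum_deltal; apply: eq_bigr => -[q y].
Qed.

(* With amplitudes 12/17, 12/17 and 1/17 on the branches, the total weight is 1,
   and a measured branch misses U|0> with probability only 1/289. *)
Definition probe (x : X) : C :=
  if x.2.1.1 then
    (if x.2.1.2 then 0 else (isqrtN / 17%:R)%:C%C * (bits_of x.1 == x.2.2)%:R)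
  else (12%:R / 17%:R)%:C%C * ((bits_of x.1 == zerov)%:R * (x.2.2 == zerov)%:R).

Lemma copy_probe_zero U q d y : copy probe U (q, ((false, d), y)) =
  (12%:R / 17%:R)%:C%C * (U q (of_bits zerov) * (y == zerov)%:R).
Proof.
rewrite /copy /probe /= sum_of_bits.
rewrite -(sum_delta_sym zerov (fun b : Bv =>
  (12%:R / 17%:R)%:C%C * (U q (of_bits b) * (y == zerov)%:R))).
by apply: eq_bigr => b _; rewrite of_bitsK; ring.
Qed.

Lemma copy_probe_choi U q y : copy probe U (q, (pauli_branch, y)) =
  (isqrtN / 17%:R)%:C%C * U q (of_bits y).
Proof.
rewrite /copy /probe /= sum_of_bits.
rewrite -(sum_delta_sym y (fun b : Bv => (isqrtN / 17%:R)%:C%C * U q (of_bits b))).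
by apply: eq_bigr => b _; rewrite of_bitsK; ring.
Qed.

Lemma copy_probe_idle U q y : copy probe U (q, ((true, true), y)) = 0.
Proof. by rewrite /copy /probe /= big1 // => b _; rewrite mulr0. Qed.

Definition pcoord (U : 'M[C]_N) : I -> C := amp probe_basis (copy probe U).

Lemma pcoord_zero U d p r : pcoord U ((false, d), (p, r)) =
  (12%:R / 17%:R)%:C%C * (entry U p zerov * (r == zerov)%:R).
Proof.
rewrite /pcoord amp_probe /amp /branch_basis /= /comp_basis /=.
transitivity (\sum_(q : 'I_N) \sum_(y : Bv) (y == r)%:R * ((bits_of q == p)%:R *
   copy probe U (q, ((false, d), y)))).
  rewrite pair_big; apply: eq_bigr => -[q y] _ /=.
  by rewrite conjcM !conjc_bool; ring.
under eq_bigr => q _ do rewrite sum_delta_sym copy_probe_zero.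
rewrite sum_of_bits; under eq_bigr => b _ do rewrite of_bitsK.
by rewrite sum_delta_sym.
Qed.

(** This is tr((X^p Z^r)^* U) / N, the Pauli coefficient of U, times the branch amplitude 1/17. *)
Lemma pcoord_pauli U p r : pcoord U (pauli_branch, (p, r)) =
  ((N%:R * 17%:R)^-1)%:C%C * \sum_y (chi r y)%:C%C * entry U (bxor y p) y.
Proof.
rewrite /pcoord amp_probe /amp /branch_basis eqxx /pauli_basis /=.
transitivity (\sum_(y : Bv) \sum_(q : 'I_N) (bits_of q == bxor y p)%:R *
   ((chi r y * isqrtN)%:C%C * copy probe U (q, (pauli_branch, y)))).
  rewrite exchange_big pair_big; apply: eq_bigr => -[q y] _ /=.
  by rewrite conjcM !conjc_bool conjc_real; ring.
rewrite mulr_sumr; apply: eq_bigr => y _.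
rewrite sum_of_bits; under eq_bigr => b _ do rewrite of_bitsK.
rewrite sum_delta_sym copy_probe_choi -/(entry _ _ _).
rewrite !mulrA -!(rmorphM (real_complex R)) /=; congr (_%:C%C * _).
transitivity (chi r y * isqrtN ^+ 2 / 17%:R); first by ring.
by rewrite isqrtN2 invfM; ring.
Qed.

Lemma pcoord_idle U pr : pcoord U ((true, true), pr) = 0.
Proof.
rewrite /pcoord amp_probe /amp big1 // => -[q y] _.
by rewrite copy_probe_idle mulr0.
Qed.

(** Stated for arbitrary matrices so as to apply to a difference of scaled unitaries. *)
Lemma pauli_parseval (M : 'M[C]_N) :
  \sum_pr abs2 (pcoord M (pauli_branch, pr)) =
  (289%:R * N%:R)^-1 * \sum_x \sum_y abs2 (entry M x y).
Proof.
rewrite /pcoord; under eq_bigr => pr _ do rewrite amp_probe.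
rewrite povm_norm; last exact: branch_basis_povm.
rewrite -(sum_of_bits (fun q => \sum_y abs2 (M q (of_bits y)))) pair_big mulr_sumr.
apply: eq_bigr => -[q y] _ /=; rewrite copy_probe_choi abs2M abs2R; congr (_ * _).
by rewrite exprMn isqrtN2 invfM exprVn mulrC; congr (_^-1 * _); ring.
Qed.

Lemma unitary_col (U : 'M[C]_N) q : unitary U -> \sum_x abs2 (U x q) = 1.
Proof.
move=> [h _]; apply: (@complexI R); rewrite (rmorph_sum (real_complex R)) /=.
have := congr1 (fun M : 'M_ _ => M q q) h; rewrite !mxE eqxx => h'.
apply: (etrans _ h'); by apply: eq_bigr => x _; rewrite adjmxE abs2C.
Qed.

Lemma unitary_col_entry (U : 'M[C]_N) y : unitary U -> \sum_x abs2 (entry U x y) = 1.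
Proof. by move=> hU; rewrite -(unitary_col (of_bits y) hU) [RHS]sum_of_bits. Qed.

Lemma unitary_entries (U : 'M[C]_N) : unitary U ->
  \sum_x \sum_y abs2 (entry U x y) = N%:R.
Proof.
move=> hU; rewrite exchange_big /=.
under eq_bigr => y _ do rewrite unitary_col_entry //.
by rewrite sumr_const card_ffun card_bool card_ord.
Qed.

Lemma pcoord_unit (U : 'M[C]_N) : unitary U -> \sum_i abs2 (pcoord U i) = 1.
Proof.
move=> hU.
transitivity (\sum_(c : bool) \sum_(d : bool) \sum_pr abs2 (pcoord U ((c, d), pr))).
  by rewrite pair_big pair_big; apply: eq_bigr => -[[]].
have hz d : \sum_pr abs2 (pcoord U ((false, d), pr)) = 144%:R / 289%:R.
  transitivity (\sum_p \sum_r (r == zerov)%:R * ((144%:R / 289%:R) * abs2 (entry U p zerov))).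
    rewrite pair_big; apply: eq_bigr => -[p r] _ /=.
    by rewrite pcoord_zero !abs2M abs2R abs2_bool; field.
  under eq_bigr => p _ do rewrite sum_delta_sym.
  by rewrite -mulr_sumr unitary_col_entry // mulr1.
rewrite !big_bool /= !hz pauli_parseval unitary_entries //.
rewrite big1 => [|pr _]; last by rewrite pcoord_idle abs2_0.
by rewrite invfM mulfVK ?gt_eqF ?N_gt0 //; field.
Qed.

Lemma copy1 (psi : X -> C) : copy psi 1%:M =1 psi.
Proof.
move=> [q y]; rewrite /copy /=.
under eq_bigr => q' _ do rewrite mxE.
by rewrite sum_deltal.
Qed.

(** The probe is its own copy under U = 1. *)
Lemma probe_unit : \sum_x abs2 (probe x) = 1.
Proof.
rewrite -(pcoord_unit (unitary1 R N)) povm_norm; last exact: probe_basis_povm.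
by apply: eq_bigr => x _; rewrite copy1.
Qed.

Definition qsupport (i : I) : {set 'I_n} := [set j | i.2.1 j || i.2.2 j]%SET.

(** Off S, U|0> keeps its zero bits. A Pauli vector with a bit flip at j outside S meets only
    vanishing entries; with a phase flip at j, translating y by the j-th unit vector keeps the entry
    and negates the character, so the sum is its own opposite. *)
Lemma pcoord_support (S : {set 'I_n}) (U : 'M[C]_N) i : junta_on S U ->
  pcoord U i != 0 -> qsupport i \subset S.
Proof.
move=> [hU hoff hshift]; case: i => -[c d] [p r].
case: c; last first.
  rewrite pcoord_zero => h; apply/fintype.subsetP => j; rewrite inE /= => hj.
  have [hr|hr] := eqVneq r zerov; last by rewrite (negPf hr) !mulr0 eqxx in h.
  have he : entry U p zerov != 0 by apply: contraNneq h => ->; rewrite mul0r mulr0.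
  apply/negPn/negP => jS; have := hoff _ _ _ he jS.
  by move: hj; rewrite hr !ffunE orbF => ->.
case: d; first by rewrite pcoord_idle eqxx.
rewrite -/pauli_branch pcoord_pauli => h; apply/fintype.subsetP => j; rewrite inE /= => hj.
apply/negPn/negP => jS; move/eqP: h; apply.
apply/eqP; rewrite mulf_eq0; apply/orP; right; apply/eqP.
have [pj|pj] := boolP (p j).
  rewrite big1 // => y _; have [->|hy] := eqVneq (entry U (bxor y p) y) 0.
    by rewrite mulr0.
  by have := hoff _ _ _ hy jS; rewrite ffunE pj; case: (y j).
have rj : r j by move: hj; rewrite (negPf pj).
pose e : Bv := [ffun l => l == j].
set s := \sum_y _; suff : s = - s.
  by move/eqP; rewrite -addr_eq0 -mulr2n mulrn_eq0 => /= /eqP.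
rewrite {1}/s (reindex_inj (inv_inj (bxorK e))) /= -sumrN; apply: eq_bigr => y _.
rewrite chi_flip // rmorphN /= mulNr; congr (- (_ * _)).
rewrite -(hshift e (bxor y p) y) => [|l lS].
  by congr entry; apply/ffunP => l; rewrite !ffunE addbAC.
by rewrite ffunE; apply: contraNF jS => /eqP <-.
Qed.

End ProbeState.

(** * Finding the relevant qubits by sampling supports *)

Section SupportSampling.
Variables (R : realType) (n m : nat) (I : finType).
Variables (p : I -> R) (supp : I -> {set 'I_n}) (S : {set 'I_n}).
Hypothesis p_ge0 : forall i, 0 <= p i.
Hypothesis p_sum1 : \sum_i p i = 1.
Hypothesis p_supp : forall i, p i != 0 -> supp i \subset S.
Hypothesis m_gt0 : (0 < m)%N.

Definition seen (o : {ffun 'I_m -> I}) : {set 'I_n} := (\bigcup_k supp (o k))%SET.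

Definition missed (S' : {set 'I_n}) : R := \sum_(i | ~~ (supp i \subset S')) p i.

Let x j := \sum_(i | j \in supp i) p i.

Let x_bound j : 0 <= x j <= 1.
Proof.
rewrite sumr_ge0 //= -p_sum1 [X in _ <= X](bigID (fun i => j \in supp i)) /=.
by rewrite lerDl sumr_ge0.
Qed.

(** Union bound: a missed index of positive weight has some j in S outside S' in its support. *)
Let missed_le S' : missed S' <= \sum_(j in S) x j * (j \notin S')%:R.
Proof.
under eq_bigr => j _ do rewrite mulr_suml.
rewrite (exchange_big_dep xpredT) //= /missed big_mkcond /=.
apply: ler_sum => i _.
have nn : 0 <= \sum_(j in S | j \in supp i) p i * (j \notin S')%:R.
  by apply: sumr_ge0 => j _; rewrite mulr_ge0.
case: ifPn => // /subsetPn[j ji jS'].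
have [->|pi] := eqVneq (p i) 0; first by apply: sumr_ge0 => l _; rewrite mul0r.
have jS : j \in S := fintype.subsetP (p_supp pi) _ ji.
rewrite (bigD1 j) ?jS //= jS' mulr1 lerDl.
by apply: sumr_ge0 => l _; rewrite mulr_ge0.
Qed.

(** Each j of S is unseen with probability (1 - x_j)^m, so the mean loss is at most the sum of x_j
    (1 - x_j)^m, that is #|S| / m; Markov's inequality with delta = 1/50 concludes. The successor of
    #|S| keeps the threshold positive when S is empty. *)
Lemma seen_success : 49%:R / 50%:R <=
  \sum_(o | (seen o \subset S) && (missed (seen o) <= 50%:R * (#|S|.+1)%:R / m%:R))
     iid p (m:=m) o.
Proof.
have mp : 0 < m%:R :> R by rewrite ltr0n.
have -> : 49%:R / 50%:R = 1 - 50%:R^-1 :> R by field.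
apply: (@markov _ _ _ (iid_ge0 p_ge0 (m:=m)) (iid_sum1 p_sum1 m)
  (fun o => \sum_(j in S) x j * (j \notin seen o)%:R)
  (50%:R * (#|S|.+1)%:R / m%:R)).
- by rewrite divr_gt0 // mulr_gt0 // ltr0n.
- move=> o; apply: sumr_ge0 => j _; rewrite mulr_ge0 //.
  by case/andP: (x_bound j).
- under eq_bigr => o _ do rewrite mulr_sumr.
  rewrite exchange_big /=.
  apply: (@le_trans _ _ (\sum_(j in S) m%:R^-1)).
    apply: ler_sum => j _; apply: le_trans (mul_exp_miss_le m_gt0 (x_bound j)).
    rewrite -(iid_miss p_sum1 m (fun i => j \in supp i)) mulr_sumr.
    apply: ler_sum => o _; rewrite mulrCA ler_wpM2l //.
      by case/andP: (x_bound j).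
    rewrite ler_wpM2l ?iid_ge0 // ler_nat.
    case: (boolP (j \in seen o)) => // jn; case: forallP => // -[k].
    by apply: contra jn => jk; apply/bigcupP; exists k.
  rewrite sumr_const -[X in X <= _]mulr_natl -[X in _ <= _ * X]mulrA mulKf ?pnatr_eq0 //.
  by rewrite ler_wpM2r ?invr_ge0 ?ler0n // ler_nat.
- move=> o po fo; apply/andP; split; last exact: le_trans (missed_le _) fo.
  apply/bigcupsP => k _; apply: p_supp; apply: contraNneq po => pk.
  by rewrite /iid (bigD1 k) //= pk mul0r.
Qed.

End SupportSampling.

(** * Estimating amplitudes by interference with a reference vector *)

Section Interference.
Variables (R : realType) (I : finType).
Local Notation C := R[i].
Variables (F : {set I}) (e : I -> C).
Hypothesis e_unit : \sum_i abs2 (e i) = 1.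
Hypothesis e_off : forall i, i \in F -> e i = 0.
Hypothesis F_gt0 : (0 < #|F|)%N.
Local Notation O := ((bool * bool) * I + I)%type.

Definition phase (bc : bool * bool) : C :=
  (if bc.1 then -1 else 1) * (if bc.2 then 'i%C else 1).

Definition rootF : R := Num.sqrt #|F|%:R.

(* Outcome (bc, j) interferes the reference e with the j-th basis vector under one
   of the four phases 1, -1, i, -i; the remaining outcomes are the columns of the
   projection onto the complement. *)
Definition interf (o : O) (i : I) : C :=
  match o with
  | inl (bc, j) => (j \in F)%:R * ((2^-1)%:C%C * ((rootF^-1)%:C%C * e i + phase bc * (i == j)%:R))
  | inr j => (i \notin F)%:R * (i == j)%:R - e i * conjc (e j)
  end.

Let rF_gt0 : 0 < rootF.
Proof. by rewrite sqrtr_gt0 ltr0n. Qed.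

Let rF2 : rootF ^+ 2 = #|F|%:R.
Proof. by rewrite sqr_sqrtr. Qed.

Let ii : 'i%C * 'i%C = -1 :> C.
Proof. by rewrite -expr2 sqr_i. Qed.

Let conji : conjc 'i%C = - 'i%C :> C.
Proof. by simpc. Qed.

Let conj_phase bc : conjc (phase bc) =
  (if bc.1 then -1 else 1) * (if bc.2 then - 'i%C else 1).
Proof.
rewrite /phase conjcM; congr (_ * _); last by case: bc.2; rewrite ?conji ?conjc1.
by case: bc.1; apply/eqP; rewrite eq_complex /= ?oppr0 !eqxx.
Qed.

Let sum_phases (f : bool * bool -> C) :
  \sum_bc f bc = f (true, true) + f (true, false) + (f (false, true) + f (false, false)).
Proof.
transitivity (\sum_b \sum_c f (b, c)); last by rewrite !big_bool.
by rewrite pair_big; apply: eq_bigr => -[].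
Qed.

Let half2 : (2^-1)%:C%C = 2^-1 :> C.
Proof. by rewrite fmorphV rmorph_nat. Qed.

Let sum_four (a b c d : C) :
  \sum_bc (2^-1)%:C%C * (a + phase bc * b) * ((2^-1)%:C%C * (c + conjc (phase bc) * d))
  = a * c + b * d.
Proof.
rewrite sum_phases !conj_phase /phase /= half2.
transitivity (a * c + b * d * ((1 - 'i%C * 'i%C) / 2)); first by field.
by rewrite ii; field.
Qed.

(** The four phases sum to zero, which cancels the cross terms: the interference outcomes add up to
    |e><e| + P_F, with P_F the projection onto the span of F. The other outcomes add up to 1 - P_F -
    |e><e|, a projection since e is a unit vector vanishing on F. *)
Lemma interf_povm : povm interf.
Proof.
move=> x x'; rewrite big_sumType /=.
have -> : \sum_(j : I) interf (inr j) x * conjc (interf (inr j) x')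
   = (x \notin F)%:R * (x == x')%:R - e x * conjc (e x').
  have ex z : (z \notin F)%:R * e z = e z.
    by case: (boolP (z \in F)) => [/e_off ->|_]; rewrite ?mulr0 ?mul1r.
  transitivity (\sum_j ((x' == j)%:R * ((x \notin F)%:R * (x' \notin F)%:R * (x == j)%:R)
     - (x == j)%:R * (((x \notin F)%:R * e j) * conjc (e x'))
     - (x' == j)%:R * (e x * conjc ((x' \notin F)%:R * e j))
     + e x * conjc (e x') * (abs2 (e j))%:C%C)).
    apply: eq_bigr => j _ /=; rewrite rmorphB /= !conjcM !conjc_bool conjcK abs2C; ring.
  rewrite big_split !sumrB /= !sum_deltal -mulr_sumr -(rmorph_sum (real_complex R)) e_unit rmorph1.
  rewrite !ex mulr1; case: eqP => [->|_]; rewrite /= ?mulr0n ?mulr1n; last by ring.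
  by case: (x' \in F); rewrite /= ?mulr0n ?mulr1n; ring.
have -> : \sum_(bj : bool * bool * I) interf (inl bj) x * conjc (interf (inl bj) x')
   = e x * conjc (e x') + (x \in F)%:R * (x == x')%:R.
  transitivity (\sum_j \sum_bc (j \in F)%:R *
     ((2^-1)%:C%C * ((rootF^-1)%:C%C * e x + phase bc * (x == j)%:R) *
      ((2^-1)%:C%C * ((rootF^-1)%:C%C * conjc (e x') + conjc (phase bc) * (x' == j)%:R)))).
    rewrite exchange_big pair_big; apply: eq_bigr => -[bc j] _ /=.
    rewrite !conjcM conjcD !conjcM !conjc_bool !conjc_real.
    by case: (j \in F); rewrite /= ?mul0r // !mul1r.
  under eq_bigr => j _ do rewrite -mulr_sumr sum_four mulrDr.
  rewrite big_split /=; congr (_ + _).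
    rewrite -mulr_suml.
    have -> : \sum_(j : I) (j \in F)%:R = (rootF ^+ 2)%:C%C :> C.
      rewrite rF2 rmorph_nat -natr_sum -sum1_card [in RHS]big_mkcond.
      by congr (_%:R); apply: eq_bigr => j _; case: (j \in F).
    have rn : rootF%:C%C != 0 :> C by rewrite fmorph_eq0 gt_eqF.
    rewrite rmorphXn fmorphV /=; field.
    exact: rn.
  under eq_bigr => j _ do rewrite mulrCA.
  by rewrite sum_deltal (eq_sym x').
by case: (x \in F); rewrite /= ?mulr0n ?mulr1n; ring.
Qed.

Variable a : I -> C.
Hypothesis a_unit : \sum_i abs2 (a i) = 1.

Definition overlap : C := \sum_i conjc (e i) * a i.

Let p (o : O) : R := abs2 (amp interf a o).

Lemma interf_ge0 o : 0 <= p o.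
Proof. exact: abs2_ge0. Qed.

Lemma interf_sum1 : \sum_o p o = 1.
Proof. by rewrite povm_norm //; apply: interf_povm. Qed.

Let amp_inl bc j : amp interf a (inl (bc, j)) =
  (j \in F)%:R * ((2^-1)%:C%C * ((rootF^-1)%:C%C * overlap + conjc (phase bc) * a j)).
Proof.
rewrite /amp /overlap -(sum_delta_sym j (fun i => conjc (phase bc) * a i)).
rewrite !mulr_sumr -big_split /= !mulr_sumr; apply: eq_bigr => i _.
rewrite !conjcM conjcD !conjcM !conjc_bool !conjc_real; ring.
Qed.

(** An unbiased estimator of conj(overlap) a_l. Weighting by the phase kills the square terms and
    the conjugate cross term, as the phases and their squares both sum to zero; [rootF] undoes the
    scaling of the reference. *)
Definition interf_obs (o : O) (l : I) : C :=
  match o with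
  | inl (bc, j) => (j \in F)%:R * ((j == l)%:R * (rootF%:C%C * phase bc))
  | inr _ => 0
  end.

Let obs_mean l : l \in F -> \sum_o (p o)%:C%C * interf_obs o l = conjc overlap * a l.
Proof.
move=> lF; rewrite big_sumType /= [X in _ + X]big1 ?addr0; last by move=> j _; rewrite mulr0.
transitivity (\sum_j (j == l)%:R * \sum_bc (p (inl (bc, j)))%:C%C *
    ((j \in F)%:R * (rootF%:C%C * phase bc))).
  under [RHS]eq_bigr => j _ do rewrite mulr_sumr.
  rewrite exchange_big pair_big; apply: eq_bigr => -[bc j] _ /=; ring.
rewrite sum_delta_sym lF.
have rn : rootF%:C%C != 0 :> C by rewrite fmorph_eq0 gt_eqF.
set g := overlap; set al := a l; set r := rootF%:C%C in rn *.
transitivity (\sum_bc ((2^-1 * (r^-1 * conjc g + phase bc * conjc al)) *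
   (2^-1 * (r^-1 * g + conjc (phase bc) * al)) * (r * phase bc))).
  apply: eq_bigr => bc _; rewrite /p abs2C amp_inl lF /= !mulr1n !mul1r.
  move: (phase bc) => ph.
  by rewrite !conjcM conjcD !conjcM conjcK !conjc_real half2 fmorphV.
rewrite sum_phases !conj_phase /phase /=.
transitivity ((conjc g * al + conjc al * g) / 2 +
  'i%C * 'i%C * (conjc al * g - conjc g * al) / 2); first by field.
by rewrite ii; field.
Qed.

(** An outcome is nonzero for at most one l, where its square is #|F|; so the bound covers all l
    together. *)
Let obs_moment : \sum_(l in F) \sum_o p o * abs2 (interf_obs o l) <= #|F|%:R.
Proof.
rewrite exchange_big /=.
apply: (@le_trans _ _ (\sum_o p o * #|F|%:R)); last by rewrite -mulr_suml interf_sum1 mul1r.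
apply: ler_sum => o _; rewrite -mulr_sumr ler_wpM2l ?interf_ge0 //.
case: o => [[bc j]|j] /=; last by rewrite big1 ?ler0n // => l _; rewrite abs2_0.
under eq_bigr => l _ do rewrite 3!abs2M !abs2_bool abs2R rF2.
have -> : abs2 (phase bc) = 1.
  rewrite /phase abs2M; case: bc => -[] [] /=; rewrite ?abs2N ?abs2_1 ?mul1r //;
  by rewrite abs2E /= expr0n add0r expr1n.
case: (boolP (j \in F)) => jF; last by rewrite big1 // => l _; rewrite mul0r.
rewrite (bigD1 j) //= eqxx big1 ?addr0 ?mul1r ?mulr1 // => l /andP[_ lj].
by rewrite eq_sym (negPf lj) mul0r mulr0.
Qed.

Variable m : nat.
Hypothesis m_gt0 : (0 < m)%N.

Definition estimate (o : {ffun 'I_m -> O}) (l : I) : C :=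
  (m%:R^-1)%:C%C * \sum_k interf_obs (o k) l.

Lemma estimate_off o l : l \notin F -> estimate o l = 0.
Proof.
move=> lF; rewrite /estimate big1 ?mulr0 // => k _.
case: (o k) => [[bc j]|j] //=; have [->|] := eqVneq j l; last by rewrite mul0r mulr0.
by rewrite (negPf lF) mul0r.
Qed.

Lemma estimate_success : 49%:R / 50%:R <=
  \sum_(o | \sum_(l in F) abs2 (estimate o l - conjc overlap * a l)
              <= 50%:R * #|F|%:R / m%:R) iid p o.
Proof.
have mp : 0 < m%:R :> R by rewrite ltr0n.
have -> : 49%:R / 50%:R = 1 - 50%:R^-1 :> R by field.
apply: (@markov _ _ _ (iid_ge0 interf_ge0 (m:=m)) (iid_sum1 interf_sum1 m)
  (fun o => \sum_(l in F) abs2 (estimate o l - conjc overlap * a l))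
  (50%:R * #|F|%:R / m%:R)) => //.
- by rewrite divr_gt0 // mulr_gt0 // ltr0n.
- by move=> o; apply: sumr_ge0 => l _; apply: abs2_ge0.
under eq_bigr => o _ do rewrite mulr_sumr.
rewrite exchange_big /=.
apply: (@le_trans _ _ (\sum_(l in F) m%:R^-1 * \sum_o p o * abs2 (interf_obs o l))).
  apply: ler_sum => l lF; rewrite -(obs_mean lF).
  exact: (iid_cvariance interf_sum1 (fun o => interf_obs o l) m_gt0).
rewrite -mulr_sumr mulrA mulrA mulVf ?mul1r ?pnatr_eq0 // mulrC.
by rewrite ler_wpM2r // invr_ge0 ltW.
Qed.

End Interference.

(** With G the squared norm of g, s = <g, u> and M = |la|^2 nu, expanding the square gives G + 3M/4
    <= 2 |la s|. By (G + 3M/4)^2 >= 3 G M this bounds |s|^2 below; g = 0 would force s = 0 and M <=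
    0. *)
Lemma overlap_of_close (R : realType) (P : finType) (g u : P -> R[i]) (la : R[i]) (nu : R) :
  0 < nu -> \sum_p abs2 (u p) = nu -> la != 0 ->
  \sum_p abs2 (g p - la * u p) <= abs2 la * nu / 4%:R ->
  0 < \sum_p abs2 (g p) /\
  (\sum_p abs2 (g p)) * nu / 4%:R <= abs2 (\sum_p conjc (g p) * u p).
Proof.
move=> nu0 hu la0 hle.
have l0 : 0 < abs2 la by rewrite lt_def abs2_eq0 la0 abs2_ge0.
set G := \sum_p abs2 (g p); set s := \sum_p conjc (g p) * u p.
have E : \sum_p abs2 (g p - la * u p) = G + abs2 la * nu - 2 * Re (la * s).
  rewrite -hu /s !mulr_sumr Re_sum mulr_sumr -big_split -sumrB /=.
  by apply: eq_bigr => p _; rewrite abs2B abs2M [conjc (g p) * _]mulrCA.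
have ht := Re_le_cabs (la * s).
have t0 := cabs_ge0 (la * s).
have t2 : cabs (la * s) ^+ 2 = abs2 la * abs2 s by rewrite -/(abs2 _) abs2M.
have G0 : 0 <= G by apply: sumr_ge0 => p _; apply: abs2_ge0.
rewrite E in hle; set t := cabs _ in ht t0 t2; set L := abs2 la in l0 t2 hle *.
have Ln : 0 < L * nu by rewrite mulr_gt0.
set M := L * nu in Ln hle.
have h1 : G + 3%:R / 4%:R * M <= 2 * t by lra.
have h2 : (G + 3%:R / 4%:R * M) ^+ 2 <= (2 * t) ^+ 2.
  by rewrite ler_sqr ?nnegrE //; lra.
have h3 : G * M <= 4%:R * (L * abs2 s).
  by rewrite -t2; have := sqr_ge0 (G - 3%:R / 4%:R * M); have := mulr_ge0 G0 (ltW Ln); nra.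
have h4 : G * nu / 4%:R <= abs2 s.
  by rewrite -(ler_pM2l l0); move: h3; rewrite /M; nra.
split=> //; rewrite lt_def G0 andbT; apply/eqP => G00.
have : abs2 s = 0.
  have z p : g p = 0.
    apply/eqP; rewrite -abs2_eq0; move: G00 => /eqP; rewrite psumr_eq0 => [/allP/(_ p)|].
      by rewrite mem_index_enum => /(_ isT).
    by move=> q _; apply: abs2_ge0.
  by rewrite /s big1 ?abs2_0 // => p _; rewrite z conjc0 mul0r.
by move=> s0; move: t2; rewrite s0 mulr0 => /eqP; rewrite sqrf_eq0 => /eqP t00; lra.
Qed.

(** * The phase-invariant distance through the Hilbert-Schmidt inner product *)

Section PhaseDistance.
Variables (R : realType) (n : nat).
Local Notation C := R[i].
Local Notation N := (2 ^ n)%N.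
Implicit Types U W : 'M[C]_N.

Definition hs_inner W U : C := \sum_x \sum_y conjc (W x y) * U x y.

Lemma sum_entry (M : 'M[C]_N) :
  \sum_x \sum_y abs2 (entry M x y) = \sum_x \sum_y abs2 (M x y).
Proof. by rewrite sum_of_bits; apply: eq_bigr => x _; rewrite [RHS]sum_of_bits. Qed.

Lemma unitary_abs2 U : unitary U -> \sum_x \sum_y abs2 (U x y) = N%:R.
Proof. by move=> hU; rewrite -sum_entry unitary_entries. Qed.

Lemma sum_abs2_lin U W (r k : C) : unitary U -> unitary W ->
  \sum_x \sum_y abs2 (r * W x y - k * U x y) =
  (abs2 r + abs2 k) * N%:R - 2 * Re (conjc r * k * hs_inner W U).
Proof.
move=> hU hW; rewrite mulrDl -{1}(unitary_abs2 hW) -(unitary_abs2 hU) /hs_inner.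
rewrite !mulr_sumr Re_sum mulr_sumr -big_split -sumrB /=; apply: eq_bigr => x _.
rewrite !mulr_sumr Re_sum mulr_sumr -big_split -sumrB /=; apply: eq_bigr => y _.
rewrite abs2B !abs2M conjcM; congr (_ - 2 * Re _); ring.
Qed.

Lemma qdist_le U W (eps : R) : unitary U -> unitary W -> 0 <= eps ->
  N%:R - cabs (hs_inner W U) <= N%:R * eps ^+ 2 -> qdist U W <= eps.
Proof.
move=> hU hW eps0 hs; set s := hs_inner W U in hs.
(* The optimal phase is conj(s) / |s|, or 1 when s = 0; it gives squared norm 2N - 2|s|. *)
have [c c1 cs] : exists2 c : C, cabs c = 1 & Re (c * s) = cabs s.
  have [s0|s0] := eqVneq s 0.
    exists 1; first by rewrite cabsE abs2_1 sqrtr1.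
    by rewrite s0 mulr0 cabsE abs2_0 sqrtr0.
  have cs0 : cabs s != 0 by rewrite -sqrf_eq0 -/(abs2 s) abs2_eq0.
  exists ((cabs s)^-1%:C%C * conjc s).
    rewrite cabsE abs2M abs2R abs2_conj exprVn mulVf ?sqrtr1 //.
    by rewrite /abs2 sqrf_eq0.
  rewrite -mulrA -abs2C -(rmorphM (real_complex R)) /= /abs2 expr2 mulKf //.
have E : \sum_x \sum_y abs2 (c * U x y - W x y) = 2 * N%:R - 2 * cabs s.
  transitivity (\sum_x \sum_y abs2 (1 * W x y - c * U x y)).
    by apply: eq_bigr => x _; apply: eq_bigr => y _; rewrite abs2_distC mul1r.
  rewrite sum_abs2_lin // conjc1 mul1r cs abs2_1 /abs2 c1 expr1n; ring.
have N0 := N_gt0 R n.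
apply: le_trans (_ : frob (c *: U - W) / Num.sqrt (2 * N)%:R <= eps).
  apply: ge_inf; last by exists c.
  exists 0 => _ [d _ <-]; rewrite divr_ge0 ?sqrtr_ge0 //.
rewrite ler_pdivrMr ?sqrtr_gt0 ?ltr0n ?muln_gt0 ?expn_gt0 //.
rewrite -[eps in X in _ <= X]ger0_norm // -sqrtr_sqr -sqrtrM ?sqr_ge0 //.
rewrite /frob ler_sqrt ?mulr_ge0 ?sqr_ge0 //.
under eq_bigr => x _ do under eq_bigr => y _ do rewrite !mxE -/(abs2 _).
rewrite E natrM; lra.
Qed.

Lemma qdist_le1 U W (eps : R) : unitary U -> unitary W -> 1 <= eps -> qdist U W <= eps.
Proof.
move=> hU hW e1; have e0 : 0 <= eps by apply: le_trans e1.
apply: qdist_le => //; have := cabs_ge0 (hs_inner W U); have := N_gt0 R n => N0 h.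
apply: (@le_trans _ _ (N%:R * 1)); first by lra.
by rewrite ler_wpM2l ?(ltW N0) // expr_ge1.
Qed.

(** Closeness of r W to k U suffices whatever the scale r, the error being measured relative to
    |k|^2. *)
Lemma qdist_le_scaled U W (r k : C) (eps d : R) : unitary U -> unitary W -> 0 <= eps ->
  k != 0 -> \sum_x \sum_y abs2 (r * W x y - k * U x y) <= d * N%:R ->
  d <= eps ^+ 2 * abs2 k -> qdist U W <= eps.
Proof.
move=> hU hW e0 k0 hle hd; apply: qdist_le => //.
move: hle; rewrite sum_abs2_lin //; set s := hs_inner W U.
have hre := Re_le_cabs (conjc r * k * s).
have hc : cabs (conjc r * k * s) = cabs r * cabs k * cabs s.
  rewrite /cabs !ComplexField.Normc.normcM; congr (_ * _ * _).
  by rewrite -!/(cabs _) !cabsE abs2_conj.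
rewrite hc in hre.
have K0 : 0 < cabs k by rewrite lt_def cabs_ge0 -sqrf_eq0 -/(abs2 k) abs2_eq0 k0.
have N0 := N_gt0 R n; have g0 := cabs_ge0 s.
move: hd; rewrite /abs2; set g := cabs s in hre g0 *; set K := cabs k in hre K0 *.
set rho := cabs r in hre *; set M := N%:R in N0 *; set t := Re _ in hre *.
move=> hd hle.
have h1 : (rho ^+ 2 + K ^+ 2) * M - 2 * (rho * K * g) <= eps ^+ 2 * K ^+ 2 * M.
  by apply: le_trans (_ : d * M <= _); [lra | rewrite ler_wpM2r // ltW].
(* Completing the square in [rho] eliminates the unknown scale. *)
have h2 : K ^+ 2 * (M ^+ 2 - g ^+ 2) <= K ^+ 2 * (eps ^+ 2 * M ^+ 2).
  have := ler_wpM2r (ltW N0) h1; have := sqr_ge0 (rho * M - K * g).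
  by nra.
rewrite ler_pM2l ?exprn_gt0 // in h2.
have [gM|/ltW Mg] := lerP g M; last first.
  have : 0 <= M * eps ^+ 2 by rewrite mulr_ge0 ?sqr_ge0 ?ltW.
  by lra.
(* For 0 <= g <= M one has M (M - g) <= (M + g)(M - g). *)
rewrite -(ler_pM2l N0); apply: le_trans (_ : M ^+ 2 - g ^+ 2 <= _); first by nra.
by have -> : M * (M * eps ^+ 2) = eps ^+ 2 * M ^+ 2 by ring.
Qed.

End PhaseDistance.

(** * Reference vectors, estimated index sets and the choice of a reference *)

Section Learner.
Variables (R : realType) (n : nat).
Local Notation C := R[i].
Local Notation N := (2 ^ n)%N.
Local Notation Bv := (bitvec n).
Local Notation I := ((bool * bool) * (Bv * Bv))%type.
Local Notation zv := (zerov n).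
Implicit Types (S : {set 'I_n}) (U W : 'M[C]_N).

Definition basis_delta (T : finType) (o i : T) : C := (o == i)%:R.

Lemma basis_delta_povm (T : finType) : povm (@basis_delta T).
Proof.
move=> x x'; under eq_bigr => o _ do rewrite /basis_delta conjc_bool.
by rewrite sum_delta_sym.
Qed.

Lemma amp_basis_delta (T : finType) (psi : T -> C) : amp (@basis_delta T) psi =1 psi.
Proof.
move=> o; rewrite /amp; under eq_bigr => i _ do rewrite /basis_delta conjc_bool.
by rewrite sum_deltal.
Qed.

Definition vecs_in S : {set Bv} := [set p : Bv | [set j | p j]%SET \subset S]%SET.

Lemma card_vecs_in S : (#|vecs_in S| <= 2 ^ #|S|)%N.
Proof.
have inj : injective (fun p : Bv => [set j | p j]%SET).
  by move=> p q /setP h; apply/ffunP => j; have := h j; rewrite !inE.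
rewrite -(card_imset _ inj) -card_powerset; apply: subset_leq_card.
by apply/fintype.subsetP => _ /imsetP[p hp ->]; rewrite inE; rewrite inE in hp.
Qed.

Lemma zerov_in S : zv \in vecs_in S.
Proof. by rewrite inE; apply/fintype.subsetP => j; rewrite inE ffunE. Qed.

Definition col_idx (d : bool) (p : Bv) : I := ((false, d), (p, zv)).
Definition pauli_idx (pr : Bv * Bv) : I := (pauli_branch, pr).

Lemma col_idx_inj d : injective (col_idx d).
Proof. by move=> p q []. Qed.

Lemma pauli_idx_inj : injective pauli_idx.
Proof. by move=> p q []. Qed.

Definition col_set S : {set I} := [set col_idx true p | p in vecs_in S]%SET.
Definition pauli_vecs S : {set Bv * Bv} := finset.setX (vecs_in S) (vecs_in S).
Definition pauli_set S : {set I} := [set pauli_idx pr | pr in pauli_vecs S]%SET.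

Lemma card_col_set S : (0 < #|col_set S| <= 2 ^ #|S|)%N.
Proof.
rewrite card_imset; last exact: col_idx_inj.
by rewrite card_vecs_in andbT; apply/card_gt0P; exists zv; apply: zerov_in.
Qed.

Lemma card_pauli_set S : (0 < #|pauli_set S| <= 4 ^ #|S|)%N.
Proof.
rewrite card_imset; last exact: pauli_idx_inj.
rewrite cardsX muln_gt0 -[4%N]/(2 * 2)%N expnMn leq_mul ?card_vecs_in // andbT andbb.
by apply/card_gt0P; exists zv; apply: zerov_in.
Qed.

Lemma col_idx_off S d p : p \notin vecs_in S -> ~~ (qsupport (col_idx d p) \subset S).
Proof.
rewrite inE; apply: contra => /fintype.subsetP h; apply/fintype.subsetP => j.
by rewrite inE => pj; apply: h; rewrite inE /= pj.
Qed.

Lemma pauli_idx_off S pr : pr \notin pauli_vecs S -> ~~ (qsupport (pauli_idx pr) \subset S).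
Proof.
rewrite inE; apply: contra => /fintype.subsetP h.
by apply/andP; split; rewrite inE; apply/fintype.subsetP => j;
  rewrite inE => pj; apply: h; rewrite inE /= pj ?orbT.
Qed.

Definition ref_vec (p : Bv) : I -> C := fun i => (i == col_idx false p)%:R.

(* the case split is only needed to obtain a unit vector when g = 0 *)
Definition col_vec (g : Bv -> C) : I -> C :=
  let G := \sum_p abs2 (g p) in
  if G == 0 then ref_vec zv else
  fun i => (i == col_idx false i.2.1)%:R * ((Num.sqrt G)^-1%:C%C * g i.2.1).

(** The generic f covers norms (f = [abs2]) and inner products (f = [id]) at once. *)
Lemma sum_col (F : Bv -> C) (A : zmodType) (f : C -> A) : f 0 = 0 ->
  \sum_(i : I) f ((i == col_idx false i.2.1)%:R * F i.2.1) = \sum_p f (F p).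
Proof.
move=> f0; rewrite (bigID (fun i : I => i \in [set col_idx false p | p : Bv]%SET)) /=.
rewrite [X in _ + X]big1 ?addr0 => [|i ni]; last first.
  case: eqP => [h|_]; last by rewrite mul0r f0.
  by case/negP: ni; rewrite h; apply/imsetP; exists i.2.1.
rewrite big_imset /=; last by move=> p q _ _; apply: col_idx_inj.
by apply: eq_bigr => p _; rewrite eqxx mul1r.
Qed.

Lemma ref_vec_unit p : \sum_i abs2 (ref_vec p i) = 1.
Proof.
under eq_bigr => i _ do rewrite /ref_vec abs2_bool -[(_ == _)%:R]mulr1.
by rewrite sum_delta_sym.
Qed.

Lemma ref_vec_overlap p (a : I -> C) : overlap (ref_vec p) a = a (col_idx false p).
Proof.
rewrite /overlap; under eq_bigr => i _ do rewrite /ref_vec conjc_bool.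
by rewrite sum_delta_sym.
Qed.

Lemma col_vec_unit g : \sum_i abs2 (col_vec g i) = 1.
Proof.
rewrite /col_vec; case: ifPn => [_|G0]; first exact: ref_vec_unit.
rewrite (sum_col (fun p => (Num.sqrt _)^-1%:C%C * g p) (@abs2_0 R)).
under eq_bigr => p _ do rewrite abs2M abs2R.
rewrite -mulr_sumr exprVn sqr_sqrtr ?mulVf //.
by apply: sumr_ge0 => p _; apply: abs2_ge0.
Qed.

Lemma col_vec_overlap g (a : I -> C) : \sum_p abs2 (g p) != 0 ->
  overlap (col_vec g) a = (Num.sqrt (\sum_p abs2 (g p)))^-1%:C%C *
    \sum_p conjc (g p) * a (col_idx false p).
Proof.
move=> G0; rewrite /overlap /col_vec (negPf G0) mulr_sumr.
set s := (Num.sqrt _)^-1%:C%C.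
rewrite -(sum_col (fun p => s * (conjc (g p) * a (col_idx false p))) (f := id)) //.
apply: eq_bigr => i _; case: eqP => [h|_]; last by rewrite !mul0r conjc0 mul0r.
by rewrite !mul1r /= conjcM /s conjc_real -mulrA {2}h.
Qed.

Lemma ref_vec_off p i : i.1 != (false, false) -> ref_vec p i = 0.
Proof. by move=> h; rewrite /ref_vec; case: eqP => // e; rewrite e in h. Qed.

Lemma col_vec_off g i : i.1 != (false, false) -> col_vec g i = 0.
Proof.
move=> h; rewrite /col_vec; case: ifP => _; first exact: ref_vec_off.
by case: eqP => [e|_]; [rewrite e in h | rewrite mul0r].
Qed.

Lemma col_set_branch S i : i \in col_set S -> i.1 != (false, false).
Proof. by case/imsetP => p _ ->. Qed.

Lemma pauli_set_branch S i : i \in pauli_set S -> i.1 != (false, false).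
Proof. by case/imsetP => p _ ->. Qed.

(** Cauchy-Schwarz, from 0 <= |a - g e|^2 = 1 - |g|^2. *)
Lemma overlap_le1 (T : finType) (e a : T -> C) : \sum_i abs2 (e i) = 1 ->
  \sum_i abs2 (a i) = 1 -> abs2 (overlap e a) <= 1.
Proof.
move=> e1 a1; set g := overlap e a.
have : 0 <= \sum_i abs2 (a i - g * e i) by apply: sumr_ge0 => i _; apply: abs2_ge0.
suff -> : \sum_i abs2 (a i - g * e i) = 1 + abs2 g * 1 - 2 * abs2 g by lra.
have -> : 1 + abs2 g * 1 = \sum_i abs2 (a i) + abs2 g * \sum_i abs2 (e i).
  by rewrite a1 e1.
rewrite [abs2 g in X in _ - X]abs2CE.
have -> : conjc g * g = \sum_i g * conjc (conjc (e i) * a i).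
  by rewrite -mulr_sumr -conjc_sum mulrC.
rewrite Re_sum !mulr_sumr -big_split -sumrB /=; apply: eq_bigr => i _.
rewrite abs2B abs2M; congr (_ - 2 * Re _).
by rewrite conjcM conjcK; ring.
Qed.

(** Outside V the estimate is zero, so the error there is |g|^2 times the weight of indices not
    supported in S, which [missed] counts. *)
Lemma sum_estimate_le (P : finType) (m : nat) (h : P -> I) (V : {set P}) S
    (o : {ffun 'I_m -> (bool * bool) * I + I}) (a : I -> C) (g : C) :
  injective h -> (forall p, p \notin V -> ~~ (qsupport (h p) \subset S)) ->
  \sum_p abs2 (estimate R [set h p | p in V]%SET o (h p) - g * a (h p)) <=
  \sum_(l in [set h p | p in V]%SET) abs2 (estimate R [set h p | p in V]%SET o l - g * a l)
  + abs2 g * missed (fun i => abs2 (a i)) (@qsupport n) S.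
Proof.
move=> hI hV; rewrite (bigID (fun p => p \in V)) /= big_imset /=; last first.
  by move=> p q _ _; apply: hI.
rewrite lerD2l /missed mulr_sumr.
have E p : p \notin V -> abs2 (estimate R [set h p | p in V]%SET o (h p) - g * a (h p))
    = abs2 g * abs2 (a (h p)).
  move=> pV; rewrite estimate_off ?sub0r ?abs2N ?abs2M //.
  by apply: contra pV => /imsetP[q qV /hI ->].
under eq_bigr => p pV do rewrite E //.
rewrite -(big_imset (h := h) (fun i => abs2 g * abs2 (a i))) /=; last first.
  by move=> p q _ _; apply: hI.
rewrite [X in _ <= X](bigID (fun i => i \in [set h p | p in ~: V]%SET)) /=.
apply: (@le_trans _ _ (\sum_(i in [set h p | p in ~: V]%SET) abs2 g * abs2 (a i))).
  rewrite le_eqVlt; apply/orP; left; apply/eqP; apply: eq_bigl => i.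
  by apply/imsetP/imsetP => -[p hp ->]; exists p => //; rewrite ?inE // in hp *.
rewrite -[X in X <= _]addr0 lerD //.
  rewrite le_eqVlt; apply/orP; left; apply/eqP; apply: eq_bigl => i.
  case: (boolP (i \in _)) => hi; rewrite ?andbF // andbT.
  by case/imsetP: hi => p hp ->; rewrite hV //; rewrite inE in hp.
by apply: sumr_ge0 => i _; rewrite mulr_ge0 ?abs2_ge0.
Qed.

Lemma pcoord_lin U W (r k : C) i :
  pcoord (r *: W - k *: U) i = r * pcoord W i - k * pcoord U i.
Proof.
rewrite /pcoord /amp !mulr_sumr -sumrB; apply: eq_bigr => x _.
rewrite /copy !mulr_sumr -sumrB; apply: eq_bigr => q _.
rewrite !mxE; ring.
Qed.

Lemma col_weight U d : unitary U -> \sum_p abs2 (pcoord U (col_idx d p)) = 144%:R / 289%:R.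
Proof.
move=> hU; transitivity (\sum_p 144%:R / 289%:R * abs2 (entry U p zv)).
  apply: eq_bigr => p _; rewrite pcoord_zero eqxx !abs2M abs2R abs2_1.
  by field.
by rewrite -mulr_sumr unitary_col_entry ?mulr1.
Qed.

Lemma pcoord_col U d p : pcoord U (col_idx d p) = pcoord U (col_idx false p).
Proof. by rewrite !pcoord_zero. Qed.

Lemma sum_first (p : I -> R) (good : pred I) :
  \sum_(o : {ffun 'I_1 -> I} | good (o ord0)) iid p o = \sum_(i | good i) p i.
Proof.
rewrite big_mkcond [RHS]big_mkcond /=.
transitivity (\prod_(k < 1) \sum_x p x * (good x)%:R).
  rewrite -(iid_prod p (fun _ x => (good x)%:R)); apply: eq_bigr => o _.
  by rewrite big_ord1; case: (good _); rewrite /= ?mulr1 ?mulr0.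
by rewrite big_ord1; apply: eq_bigr => x _; case: (good x); rewrite /= ?mulr1 ?mulr0.
Qed.

(** A bad sample lies off the U|0> branches, with probability 1/289, or is one of at most 2 * 2^k
    column indices of weight below t, with probability at most 2/210 in total; the sum is below
    1/50. *)
Lemma ref_success S U : junta_on S U ->
  49%:R / 50%:R <= \sum_(o : {ffun 'I_1 -> I} | ~~ (o ord0).1.1 &&
     ((210%:R * 2%:R ^+ #|S|)^-1 <= abs2 (pcoord U (o ord0))))
       iid (fun i => abs2 (pcoord U i)) o.
Proof.
move=> hJ; have hU := junta_on_unitary hJ.
set t := (210%:R * 2%:R ^+ #|S|)^-1.
pose good (i : I) := ~~ i.1.1 && (t <= abs2 (pcoord U i)).
rewrite (sum_first _ good).
have := pcoord_unit hU; rewrite (bigID good) /= => E.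
suff : \sum_(i | ~~ good i) abs2 (pcoord U i) <= 50%:R^-1 by lra.
have t0 : 0 < t by rewrite invr_gt0 mulr_gt0 // ?exprn_gt0.
apply: (@le_trans _ _ (\sum_(i : I | i.1.1) abs2 (pcoord U i) +
    \sum_(i in [set col_idx dp.1 dp.2 | dp in finset.setX [set: bool]%SET (vecs_in S)]%SET) t)).
  rewrite !(big_mkcond (fun i : I => i.1.1)) (big_mkcond (fun i : I => i \in _)).
  rewrite [X in X <= _]big_mkcond -big_split /=; apply: ler_sum => i _.
  have t'0 : 0 <= (if i \in [set col_idx dp.1 dp.2 | dp in finset.setX [set: bool]%SET (vecs_in S)]%SET
       then t else 0) by case: ifP => _ //; apply: ltW.
  case: ifPn => ng; last by rewrite addr_ge0 //; case: ifP => _ //; apply: abs2_ge0.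
  move: ng; rewrite /good; have [i1|/negbTE i1] := boolP i.1.1; first by rewrite lerDl.
  rewrite -ltNge add0r => lt.
  have [z|nz] := eqVneq (pcoord U i) 0; first by rewrite z abs2_0.
  rewrite ifT ?(ltW lt) //.
  have hs := pcoord_support hJ nz.
  case: i i1 nz hs {lt t'0} => -[c d] [p r] /= -> nz hs.
  have r0 : r = zv.
    apply/eqP; apply: contraNT nz => rn.
    by rewrite pcoord_zero (negPf rn) !mulr0.
  apply/imsetP; exists (d, p); last by rewrite r0.
  rewrite !inE /=; apply/fintype.subsetP => j; rewrite inE => pj.
  by apply: (fintype.subsetP hs); rewrite inE /= pj.
have E1 : \sum_(i : I | i.1.1) abs2 (pcoord U i) = 289%:R^-1.
  transitivity (\sum_(c : bool) \sum_(d : bool)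
      \sum_pr (if c then abs2 (pcoord U ((c, d), pr)) else 0)).
    by rewrite pair_big pair_big big_mkcond /=; apply: eq_bigr => -[[]].
  rewrite !big_bool /= !(big1 _ _ (fun _ => 0)) ?addr0 //.
  rewrite [X in X + _]big1 => [|pr _]; last by rewrite pcoord_idle abs2_0.
  rewrite add0r (pauli_parseval U) unitary_entries //.
  by rewrite invfM mulfVK ?gt_eqF ?N_gt0.
have E2 : \sum_(i in [set col_idx dp.1 dp.2 | dp in finset.setX [set: bool]%SET (vecs_in S)]%SET) t
   <= 2%:R * 2%:R ^+ #|S| * t.
  rewrite sumr_const -[X in X <= _]mulr_natl ler_wpM2r ?(ltW t0) //.
  rewrite -natrX -natrM ler_nat; apply: (leq_trans (leq_imset_card _ _)).
  by rewrite cardsX cardsT card_bool leq_mul2l card_vecs_in.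
rewrite E1; apply: (le_trans (lerD (lexx _) E2)).
have p0 : 2%:R ^+ #|S| != 0 :> R by rewrite expf_neq0 // pnatr_eq0.
have -> : 2%:R * 2%:R ^+ #|S| * t = 2%:R / 210%:R.
  by rewrite /t invfM mulrCA; field.
by lra.
Qed.

End Learner.

(** * Error analysis of the two estimation rounds *)

Section Phases.
Variables (R : realType) (n m : nat).
Local Notation C := R[i].
Local Notation N := (2 ^ n)%N.
Local Notation Bv := (bitvec n).
Local Notation I := ((bool * bool) * (Bv * Bv))%type.
Local Notation O := ((bool * bool) * I + I)%type.
Variables (S S' : {set 'I_n}) (U : 'M[C]_N).
Hypothesis US : junta_on S U.
Hypothesis S'S : S' \subset S.
Local Notation k := #|S|.
Hypothesis m_large : 10%:R ^+ 6 * 4%:R ^+ k <= m%:R :> R.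
Hypothesis S'_missed :
  missed (fun i => abs2 (pcoord U i)) (@qsupport n) S' <= 50%:R * k.+1%:R / m%:R.

Let hU := junta_on_unitary US.

Let p4E : 4%:R ^+ k = 2%:R ^+ k * 2%:R ^+ k :> R.
Proof. by rewrite -exprMn -natrM. Qed.

Let k_le : k.+1%:R <= 4%:R ^+ k :> R.
Proof.
rewrite -natrX ler_nat; apply: leq_trans (ltn_expl k (isT : (1 < 2)%N)) _.
by case: (k) => // j; rewrite leq_exp2r.
Qed.

Let m_gt0 : 0 < m%:R :> R.
Proof. by apply: lt_le_trans m_large; rewrite mulr_gt0 ?exprn_gt0. Qed.

Let missed_ge0 : 0 <= missed (fun i => abs2 (pcoord U i)) (@qsupport n) S'.
Proof. by apply: sumr_ge0 => i _; apply: abs2_ge0. Qed.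

(** The reference overlap may be as small as order 2^-k in square, but m of order 4^k makes the
    error a small fraction of it. The estimated column then has squared overlap at least a quarter
    of the column weight 144/289. *)
Lemma col_phase (p0 : Bv) (o : {ffun 'I_m -> O}) :
  (210%:R * 2%:R ^+ k)^-1 <= abs2 (pcoord U (col_idx false p0)) ->
  \sum_(l in col_set S') abs2 (estimate R (col_set S') o l -
      conjc (overlap (ref_vec R p0) (pcoord U)) * pcoord U l)
    <= 50%:R * #|col_set S'|%:R / m%:R ->
  36%:R / 289%:R <=
    abs2 (overlap (col_vec (fun p => estimate R (col_set S') o (col_idx true p))) (pcoord U)).
Proof.
pose g (p : Bv) := estimate R (col_set S') o (col_idx true p).
rewrite -/g ref_vec_overlap; set ga := pcoord U _ => hga hest.
have t0 : 0 < (210%:R * 2%:R ^+ k)^-1 :> R by rewrite invr_gt0 mulr_gt0 ?exprn_gt0.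
have ga0 : 0 < abs2 ga by apply: lt_le_trans hga.
have hcard : #|col_set S'|%:R <= 2%:R ^+ k :> R.
  have /andP[_ h] := card_col_set S'; rewrite -natrX ler_nat; apply: (leq_trans h).
  by rewrite leq_exp2l // subset_leq_card.
have tot := sum_estimate_le o (pcoord U) (conjc ga) (@col_idx_inj n true)
   (@col_idx_off n S' true).
have hfin : 50%:R * #|col_set S'|%:R / m%:R + abs2 ga * (50%:R * k.+1%:R / m%:R)
    <= abs2 ga * (144%:R / 289%:R) / 4%:R.
  have h1 : 1 <= abs2 ga * (210%:R * 2%:R ^+ k).
    by rewrite -ler_pdivrMr ?mulr_gt0 ?exprn_gt0 // div1r.
  (* Here 10500 = 50 * 210: one factor 2^k counts the coordinates, the other comes from the lower
     bound on |ga|^2. *)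
  have h2 : 50%:R * #|col_set S'|%:R / m%:R <= abs2 ga * (10500%:R * 10%:R ^- 6).
    rewrite (ler_pdivrMr _ _ m_gt0).
    apply: le_trans (_ : 50%:R * 2%:R ^+ k <= _); first by rewrite ler_wpM2l.
    apply: le_trans (_ : 50%:R * 2%:R ^+ k * (abs2 ga * (210%:R * 2%:R ^+ k)) <= _).
      by rewrite ler_peMr // mulr_ge0 ?exprn_ge0.
    have := ler_wpM2l (ltW ga0) m_large; rewrite p4E => h; lra.
  have h3 : 50%:R * k.+1%:R / m%:R <= 50%:R * 10%:R ^- 6 :> R.
    by rewrite ler_pdivrMr ?m_gt0 //; have := k_le; move: m_large; lra.
  have := ler_wpM2l (ltW ga0) h3; lra.
have hle : \sum_p abs2 (g p - conjc ga * pcoord U (col_idx true p))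
    <= abs2 (conjc ga) * (144%:R / 289%:R) / 4%:R.
  apply: (le_trans tot); rewrite abs2_conj; apply: le_trans hfin.
  by rewrite lerD // ler_wpM2l ?abs2_ge0.
have nu0 : 0 < 144%:R / 289%:R :> R by lra.
have cg0 : conjc ga != 0 by rewrite -abs2_eq0 abs2_conj gt_eqF.
have [G0 hG] := overlap_of_close nu0 (col_weight true hU) cg0 hle.
rewrite col_vec_overlap ?gt_eqF // abs2M abs2R exprVn sqr_sqrtr ?(ltW G0) //.
rewrite [X in _ <= X]mulrC ler_pdivlMr //.
under [X in _ <= abs2 X]eq_bigr => p _ do rewrite -(pcoord_col U true).
by apply: le_trans hG; lra.
Qed.

Definition pauli_close (W : 'M[C]_N) (r : C) (b : Bv * Bv -> C) :=
  \sum_pr abs2 (r * pcoord W (pauli_idx pr) - b pr) <= 100%:R * 4%:R ^+ k / m%:R.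

Lemma pauli_phase (e : I -> C) (o : {ffun 'I_m -> O}) :
  \sum_i abs2 (e i) = 1 ->
  \sum_(l in pauli_set S') abs2 (estimate R (pauli_set S') o l -
      conjc (overlap e (pcoord U)) * pcoord U l)
    <= 50%:R * #|pauli_set S'|%:R / m%:R ->
  pauli_close U (conjc (overlap e (pcoord U)))
    (fun pr => estimate R (pauli_set S') o (pauli_idx pr)).
Proof.
move=> e1 hest; rewrite /pauli_close; set ka := conjc _ in hest *.
have ka1 : abs2 ka <= 1 by rewrite abs2_conj overlap_le1 ?pcoord_unit.
have hcard : #|pauli_set S'|%:R <= 4%:R ^+ k :> R.
  have /andP[_ h] := card_pauli_set S'; rewrite -natrX ler_nat; apply: (leq_trans h).
  by rewrite leq_exp2l // subset_leq_card.
have tot := sum_estimate_le o (pcoord U) ka (@pauli_idx_inj n) (@pauli_idx_off n S').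
under eq_bigr => pr _ do rewrite abs2_distC.
apply: (le_trans tot); apply: (le_trans (lerD hest (_ : _ <= 50%:R * k.+1%:R / m%:R))).
  by apply: le_trans S'_missed; rewrite ler_piMl.
by rewrite -mulrDl ler_wpM2r ?invr_ge0 ?(ltW m_gt0) //; have := k_le; lra.
Qed.

(** The triangle inequality costs 4 and Parseval 289, giving 1156 = 4 * 289. The constant 10^6 is
    large enough because 1156 * 100 * 289 / 36 is about 928000. *)
Lemma pauli_close_qdist (W : 'M[C]_N) (r ka : C) (b : Bv * Bv -> C) (eps : R) :
  unitary W -> 0 <= eps -> 36%:R / 289%:R <= abs2 ka ->
  10%:R ^+ 6 * 4%:R ^+ k <= m%:R * eps ^+ 2 ->
  pauli_close U ka b -> pauli_close W r b -> qdist U W <= eps.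
Proof.
rewrite /pauli_close => hW e0 hka hm hUb hWb.
set tau := 100%:R * 4%:R ^+ k / m%:R in hUb hWb.
have ka0 : ka != 0 by rewrite -abs2_eq0 gt_eqF //; apply: lt_le_trans hka; lra.
have N0 := N_gt0 R n.
have close : \sum_pr abs2 (pcoord (r *: W - ka *: U) (pauli_branch, pr)) <= 4%:R * tau.
  apply: (@le_trans _ _ (\sum_pr (2 * abs2 (r * pcoord W (pauli_idx pr) - b pr) +
      2 * abs2 (ka * pcoord U (pauli_idx pr) - b pr)))).
    apply: ler_sum => pr _; rewrite pcoord_lin.
    apply: (le_trans (abs2_triangle _ (b pr) _)).
    by rewrite [abs2 (b pr - _)]abs2_distC.
  by rewrite big_split /= -!mulr_sumr; lra.
rewrite pauli_parseval sum_entry ler_pdivrMl ?mulr_gt0 // in close.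
apply: (@qdist_le_scaled _ _ _ _ r ka _ (1156%:R * tau)) => //.
  under eq_bigr => x _ do under eq_bigr => y _ do
    have -> : r * W x y - ka * U x y = (r *: W - ka *: U) x y by rewrite !mxE.
  by apply: (le_trans close); rewrite le_eqVlt; apply/orP; left; apply/eqP; ring.
apply: (@le_trans _ _ (eps ^+ 2 * (36%:R / 289%:R))); last first.
  by rewrite ler_wpM2l ?sqr_ge0.
have q0 : 0 <= 4%:R ^+ k :> R by rewrite exprn_ge0.
by rewrite /tau mulrA ler_pdivrMr //; lra.
Qed.

End Phases.

(** * Assembly of the learner and its query count *)

Lemma junta_learner (R : realType) (n k m : nat) (eps : R) :
  0 < eps -> eps <= 1 -> (0 < m)%N -> 10%:R ^+ 6 * 4%:R ^+ k <= m%:R * eps ^+ 2 ->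
  exists A : query_alg R n, nqueries A = (m + (1 + (m + m)))%N /\
    forall U, is_junta k U -> 9%:R / 10%:R <= success_prob A U eps.
Proof.
move=> eps0 eps1 m0 hm.
have m_large : 10%:R ^+ 6 * 4%:R ^+ k <= m%:R :> R.
  by apply: (le_trans hm); rewrite ler_piMr // exprn_ile1 // ltW.
pose I := ((bool * bool) * (bitvec n * bitvec n))%type.
pose O := ((bool * bool) * I + I)%type.
(* Post-processing depends on the estimate b alone: it picks a unitary whose scaled Pauli
   coefficients are close to b if there is one, and the identity otherwise. *)
have /choice[out hout] : forall b : bitvec n * bitvec n -> R[i],
    exists M : 'M[R[i]]_(2 ^ n), unitary M /\ ((exists W r, unitary W /\
      \sum_pr abs2 (r * pcoord W (pauli_idx pr) - b pr) <= 100%:R * 4%:R ^+ k / m%:R) ->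
      exists r, \sum_pr abs2 (r * pcoord M (pauli_idx pr) - b pr)
                  <= 100%:R * 4%:R ^+ k / m%:R).
  move=> b.
  have [[W [r [hW hr]]]|no] := pselect (exists W r, unitary W /\
      \sum_pr abs2 (r * pcoord W (pauli_idx pr) - b pr) <= 100%:R * 4%:R ^+ k / m%:R).
    by exists W; split=> // _; exists r.
  by exists 1%:M; split=> //; apply: unitary1.
(* Stages: A finds the support, B a reference coordinate, C the column U|0>, D the Pauli
   coefficients; they use m, 1, m and m copies. *)
pose St (oA : {ffun 'I_m -> I}) := seen (@qsupport n) oA.
pose gh oA (oC : {ffun 'I_m -> O}) p := estimate R (col_set (St oA)) oC (col_idx true p).
pose bh oA (oD : {ffun 'I_m -> O}) pr := estimate R (pauli_set (St oA)) oD (pauli_idx pr).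
pose PA (U : 'M[R[i]]_(2 ^ n)) (o : {ffun 'I_m -> I}) := iid (fun i => abs2 (pcoord U i)) o.
pose PB (U : 'M[R[i]]_(2 ^ n)) (o : {ffun 'I_1 -> I}) := iid (fun i => abs2 (pcoord U i)) o.
pose PC oA (oB : {ffun 'I_1 -> I}) (U : 'M[R[i]]_(2 ^ n)) (o : {ffun 'I_m -> O}) :=
  iid (fun x => abs2 (amp (interf (col_set (St oA)) (ref_vec R (oB ord0).2.1)) (pcoord U) x)) o.
pose PD oA oC (U : 'M[R[i]]_(2 ^ n)) (o : {ffun 'I_m -> O}) :=
  iid (fun x => abs2 (amp (interf (pauli_set (St oA)) (col_vec (gh oA oC))) (pcoord U) x)) o.
have povmC oA (oB : {ffun 'I_1 -> I}) :
    povm (interf (col_set (St oA)) (ref_vec R (oB ord0).2.1)).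
  apply: interf_povm; first exact: ref_vec_unit.
    by move=> i /col_set_branch; apply: ref_vec_off.
  by case/andP: (card_col_set (St oA)).
have povmD oA oC : povm (interf (pauli_set (St oA)) (col_vec (gh oA oC))).
  apply: interf_povm; first exact: col_vec_unit.
    by move=> i /pauli_set_branch; apply: col_vec_off.
  by case/andP: (card_pauli_set (St oA)).
have sI T : samplable (@probe R n) T
    (fun U (o : {ffun 'I_T -> I}) => iid (fun i => abs2 (pcoord U i)) o).
  have := samplable_iid (@probe R n) T (@probe_basis_povm R n) (@basis_delta_povm R I).
  congr (samplable _ _ _); apply/funext => U; apply/funext => o.
  by apply: eq_bigr => t _; rewrite amp_basis_delta.
have sAll : samplable (@probe R n) (m + (1 + (m + m)))
    (fun U (o : {ffun 'I_m -> I} * ({ffun 'I_1 -> I} * ({ffun 'I_m -> O} * {ffun 'I_m -> O}))) =>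
      PA U o.1 * (PB U o.2.1 * (PC o.1 o.2.1 U o.2.2.1 * PD o.1 o.2.2.1 U o.2.2.2))).
  apply: (samplable_bind (P2 := fun oA U o =>
      PB U o.1 * (PC oA o.1 U o.2.1 * PD oA o.2.1 U o.2.2))); first exact: sI.
  move=> oA; apply: (samplable_bind (P2 := fun oB U o =>
      PC oA oB U o.1 * PD oA o.1 U o.2)); first exact: sI.
  move=> oB; apply: (samplable_bind (P1 := PC oA oB) (P2 := PD oA)).
    exact: (samplable_iid (@probe R n) m (@probe_basis_povm R n) (povmC oA oB)).
  move=> oC.
  exact: (samplable_iid (@probe R n) m (@probe_basis_povm R n) (povmD oA oC)).
case: sAll => w hw hP.
have cB : #|{: (bool * bool) * bitvec n}| = (2 ^ n.+2)%N.
  by rewrite !card_prod card_ffun !card_bool card_ord !expnS mulnA.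
have T0 : (0 < m + (1 + (m + m)))%N by rewrite addn_gt0 m0.
have [A [hA hsucc]] := copies_circuit cB (probe_unit R n) T0 hw
  (fun o => (hout (bh o.1 o.2.2.2)).1).
exists A; split=> // U hU.
have [S [cS US]] := is_juntaP hU.
have hu := junta_on_unitary US; have au := pcoord_unit hu.
apply: le_trans (hsucc U eps).
under eq_bigr => o _ do rewrite -hP.
have g4950 : 0 <= 49%:R / 50%:R :> R by lra.
(* Four stages, each failing with probability at most 1/50. *)
apply: (@le_trans _ _ (49%:R / 50%:R * (49%:R / 50%:R * (49%:R / 50%:R * (49%:R / 50%:R))))).
  by lra.
have sub x : abs2 (pcoord U x) != 0 -> qsupport x \subset S.
  by rewrite abs2_eq0; apply: pcoord_support.
have iidge T (X : finType) (p : X -> R[i]) (o : {ffun 'I_T -> X}) : 0 <= iid (fun x => abs2 (p x)) o.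
  by apply: iid_ge0 => x; apply: abs2_ge0.
apply: (chain_success (p1 := PA U)
    (p2 := fun oA o => PB U o.1 * (PC oA o.1 U o.2.1 * PD oA o.2.1 U o.2.2))
    _ _ _ (seen_success (fun i => abs2_ge0 (pcoord U i)) au sub m0)).
- by move=> o; apply: iidge.
- by move=> oA o; rewrite !mulr_ge0 //; apply: iidge.
- by lra.
move=> oA /andP[hsub hmiss].
apply: (chain_success (p1 := PB U)
    (p2 := fun oB o => PC oA oB U o.1 * PD oA o.1 U o.2)
    (g := fun o => qdist U (out (bh oA o.2.2)) <= eps)
    _ _ _ (ref_success US)).
- by move=> o; apply: iidge.
- by move=> oB o; rewrite !mulr_ge0 //; apply: iidge.
- by lra.
move=> oB /andP[hbr href].
(* Only p is kept from the sample: both copies of U|0> have the same coordinates, and a coordinate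
   with r nonzero vanishes, which the lower bound excludes. *)
have href' : (210%:R * 2%:R ^+ #|S|)^-1 <= abs2 (pcoord U (col_idx false (oB ord0).2.1)).
  move: hbr href; case: (oB ord0) => -[[] d] [p r] //= _.
  have [->|nr] := eqVneq r (zerov n); first by rewrite -(pcoord_col U d).
  rewrite pcoord_zero (negPf nr) !mulr0 abs2_0 => h; apply: (le_trans h).
  exact: abs2_ge0.
have FC0 : (0 < #|col_set (St oA)|)%N by case/andP: (card_col_set (St oA)).
have FD0 : (0 < #|pauli_set (St oA)|)%N by case/andP: (card_pauli_set (St oA)).
apply: (chain_success (p1 := PC oA oB U) (p2 := fun oC o => PD oA oC U o)
    (g := fun o => qdist U (out (bh oA o.2)) <= eps)
    _ _ _ (estimate_success (ref_vec_unit R (oB ord0).2.1) _ FC0 au m0)) => //.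
- by move=> o; apply: iidge.
- by move=> oC o; apply: iidge.
- by move=> i /col_set_branch; apply: ref_vec_off.
move=> oC hC.
have m_large' : 10%:R ^+ 6 * 4%:R ^+ #|S| <= m%:R :> R by rewrite cS.
have hk := col_phase US hsub m_large' hmiss href' hC.
have offD i : i \in pauli_set (St oA) -> col_vec (gh oA oC) i = 0.
  by move=> /pauli_set_branch; apply: col_vec_off.
apply: (le_trans (estimate_success (col_vec_unit (gh oA oC)) offD FD0 au m0)).
rewrite [X in X <= _]big_mkcond [X in _ <= X]big_mkcond /=; apply: ler_sum => oD _.
case: ifP => [hD|_]; last by case: ifP => _ //; apply: iidge.
rewrite ifT //.
have cU := pauli_phase US hsub m_large' hmiss (col_vec_unit (gh oA oC)) hD.
have [hW hex] := hout (bh oA oD).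
(* U itself is close to the estimate, so the output is the chosen close unitary and not the
   default. *)
have [r hr] : exists r, \sum_pr abs2 (r * pcoord (out (bh oA oD)) (pauli_idx pr) - bh oA oD pr)
                  <= 100%:R * 4%:R ^+ k / m%:R.
  by apply: hex; exists U, (conjc (overlap (col_vec (gh oA oC)) (pcoord U))); rewrite -cS.
apply: (pauli_close_qdist US m_large' hW (ltW eps0) _ _ cU).
- by rewrite abs2_conj; apply: hk.
- by rewrite cS.
by rewrite /pauli_close cS; apply: hr.
Qed.

Theorem mainTheorem5 :
  exists c : nat, (0 < c)%N /\
  forall (R : realType) (n k : nat) (eps : R), 0 < eps ->
  exists A : query_alg R n,
    (nqueries A)%:R <= c%:R * (k%:R / eps + 4%:R ^+ k / eps ^+ 2) /\
    forall U : 'M[R[i]]_(2 ^ n), is_junta k U ->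
      9%:R / 10%:R <= success_prob A U eps.
Proof.
(* With y = 4^k / eps^2 >= 1 and m = floor(10^6 y) + 1, the 3m + 1 queries number at most 3 * 10^6 y
   + 4 <= 4 * 10^6 y. *)
exists (4 * 10 ^ 6)%N; split; first by rewrite muln_gt0 expn_gt0.
move=> R n k eps eps0.
have ke0 : 0 <= k%:R / eps by rewrite divr_ge0 // ltW.
have q1 : 1 <= 4%:R ^+ k :> R by rewrite -natrX ler1n expn_gt0.
have e2 : 0 < eps ^+ 2 by rewrite exprn_gt0.
have [e1|e1] := lerP eps 1; last first.
  (* For eps > 1 every unitary is within eps, so the identity is output without a query. *)
  pose A := @QueryAlg R n 0 0 (fun=> 1%:M) (fun=> @unitary1 R _) (fun=> 1%:M)
              (fun=> @unitary1 R _).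
  exists A; split.
    by apply: mulr_ge0 => //; rewrite addr_ge0 // divr_ge0 ?exprn_ge0 // ltW.
  move=> U /is_juntaP[S [_ US]].
  rewrite /success_prob (eq_bigl xpredT); last first.
    by move=> o; rewrite qdist_le1 ?ltW //; [apply: junta_on_unitary US | apply: unitary1].
  rewrite /final_state /= mul1mx (bigD1 (zero_idx n 0)) //= mxE !eqxx -/(abs2 _) abs2_1.
  rewrite -[X in X <= _]addr0 lerD //; first by lra.
  by apply: sumr_ge0 => o _; apply: abs2_ge0.
pose y : R := 4%:R ^+ k / eps ^+ 2.
have y1 : 1 <= y by rewrite ler_pdivlMr // mul1r (le_trans _ q1) // exprn_ile1 // ltW.
have x0 : 0 <= 10%:R ^+ 6 * y by rewrite mulr_ge0 ?exprn_ge0 ?(le_trans ler01 y1).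
have /andP[tl tg] := truncn_itv x0.
set m := (Num.truncn (10%:R ^+ 6 * y)).+1 in tg.
have hm : 10%:R ^+ 6 * 4%:R ^+ k <= m%:R * eps ^+ 2.
  by rewrite -ler_pdivrMr // -mulrA ltW.
have [A [hA hs]] := junta_learner n eps0 e1 (ltn0Sn _) hm.
exists A; split=> //; rewrite hA natrM natrX -/y.
have mE : m%:R = (Num.truncn (10%:R ^+ 6 * y))%:R + 1 :> R by rewrite natr1.
by rewrite !natrD mE; lra.
Qed.
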